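(* Every graph $G$ on $n$ vertices admits a $K_4$-separating system of size at most $82n$; that is, there is a family $\mathcal{F}$ with $|\mathcal{F}|\le 82n$, each member of which is a subgraph of $G$ that is either a single edge or a subdivision of $K_4$, such that for every ordered pair $(e,f)$ of distinct edges of $G$ there is $F\in\mathcal{F}$ with $e\in E(F)$ and $f\notin E(F)$.
   Context: Graphs are finite and simple. A graph $H^*$ is a subdivision of $H$ if $H$ can be obtained from $H^*$ by repeatedly deleting a vertex of degree $2$ and adding a new edge joining its two neighbors. For graphs $H$ and $G$, an $H$-separating system of $G$ is a family $\mathcal{F}$ of subgraphs of $G$, each of which is either an edge or a subdivision of $H$, such that for all distinct edges $e,f$ of $G$ (as an ordered pair) some member of $\mathcal{F}$ contains $e$ but not $f$. *)

(* Defs.v *)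
From HB Require Import structures.
From mathcomp Require Import all_boot.

Set Implicit Arguments.
Unset Strict Implicit.
Unset Printing Implicit Defensive.

Section Graph.

Variable T : finType.

Definition graph_axiom (p : {set T} * {set {set T}}) : bool :=
  [forall e in p.2, (#|e| == 2) && (e \subset p.1)].

(* The vertex set is a subset of the ambient type [T], not all of [T], so that
   a graph, its subgraphs, and the graphs obtained from these by suppressing
   vertices all have the same type.  An edge is the set of its two ends. *)
Record graph := Graph {
  graph_val : {set T} * {set {set T}};
  _ : graph_axiom graph_val
}.

HB.instance Definition _ := [isSub for graph_val].
HB.instance Definition _ := [Finite of graph by <:].

Definition vertices (G : graph) : {set T} := (graph_val G).1.
Definition edges (G : graph) : {set {set T}} := (graph_val G).2.

Definition adj (G : graph) : rel T := fun x y => [set x; y] \in edges G.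
Definition neighbors (G : graph) (v : T) : {set T} := [set x | adj G v x].
Definition degree (G : graph) (v : T) : nat := #|neighbors G v|.

Definition subgraph (F G : graph) : bool :=
  (vertices F \subset vertices G) && (edges F \subset edges G).

Definition single_edge (F : graph) : Prop :=
  exists e : {set T}, vertices F = e /\ edges F = [set e].

(* [F'] arises from [F] by deleting a vertex of degree 2 and joining its two
   neighbors by a new edge.  The neighbors must not already be adjacent:
   otherwise the result would have parallel edges. *)
Definition suppression (F F' : graph) : Prop :=
  exists v x y : T,
    [/\ v \in vertices F,
        degree F v = 2 /\ neighbors F v = [set x; y],
        ~~ adj F x y,
        vertices F' = vertices F :\ v
      & edges F' = [set x; y] |: [set e in edges F | v \notin e]].

End Graph.

Definition isomorphic (T U : finType) (G : graph T) (H : graph U) : Prop :=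
  exists f : {x : T | x \in vertices G} -> {y : U | y \in vertices H},
    bijective f /\
    forall x y, adj H (val (f x)) (val (f y)) = adj G (val x) (val y).

Inductive subdivision (T U : finType) (H : graph U) : graph T -> Prop :=
| subdivision_iso (F : graph T) :
    isomorphic F H -> subdivision H F
| subdivision_suppression (F F' : graph T) :
    suppression F F' -> subdivision H F' -> subdivision H F.

Definition separating_system (T U : finType) (H : graph U) (G : graph T)
    (FF : {set graph T}) : Prop :=
  (forall F, F \in FF ->
     subgraph F G /\ (single_edge F \/ subdivision H F)) /\
  (forall e f, e \in edges G -> f \in edges G -> e != f ->
     exists2 F, F \in FF & (e \in edges F) && (f \notin edges F)).

Lemma complete_graph_axiom (k : nat) :
  graph_axiom ([set: 'I_k], [set e : {set 'I_k} | #|e| == 2]).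
Proof. by apply/forall_inP => e; rewrite inE => -> /=; apply: subsetT. Qed.

Definition complete_graph (k : nat) : graph 'I_k :=
  Graph (complete_graph_axiom k).

(* Main.v *)
Require Import Defs.
From mathcomp Require Import all_boot.
From mathcomp Require Import zify.

(* By Posa's rotation argument some nonempty set S has |S u N(S)| <= 3|S| and a
   cycle c through W = S u N(S) (or S meets at most one edge).  Remove S by
   induction; it remains to treat the edges at S, viewed as chords between the
   points of W on c.  O(|W|) of them are taken as single edges: those joining
   consecutive points of W and a maximal noncrossing set of chords.  Every other
   chord (i, j) crosses one of these.  Chords with the same difference j - i, or
   the same j - 2i, form a chain increasing in both coordinates.  A chain splits
   into three families of blocks of pairwise crossing chords; a cycle that runs
   along c and zigzags through the blocks contains the whole family, and together
   with a segment of c or one noncrossing chord it contains a subdivision of K4.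
   The pair (j - i, j - 2i) determines the chord, so these subdivisions separate
   the chords from each other.  To separate them from all remaining edges, cover
   the graph formed by the chords alone by O(|W|) edges and subdivisions of K4,
   using the same induction with the differences j - i only. *)

Set Implicit Arguments.
Unset Strict Implicit.
Unset Printing Implicit Defensive.

(** * Zigzags through chords of a line *)

Fixpoint steps (A : Type) (x : A) (p : seq A) : seq (A * A) :=
  if p is y :: p' then (x, y) :: steps y p' else [::].

Definition swap (A : Type) (u : A * A) : A * A := (u.2, u.1).

Lemma steps_cat (A : Type) (x : A) p y q :
  steps x (p ++ y :: q) = steps x p ++ (last x p, y) :: steps y q.
Proof. by elim: p x => [|z p IHp] x //=; rewrite IHp. Qed.

Lemma steps_cats (A : Type) (x : A) p q :
  steps x (p ++ q) = steps x p ++ steps (last x p) q.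
Proof. by case: q => [|y q]; rewrite ?cats0 // steps_cat. Qed.

Lemma mem_steps (A : eqType) (x : A) p u :
  u \in steps x p -> (u.1 \in x :: p) && (u.2 \in x :: p).
Proof.
elim: p x => [|y p IHp] x //=; rewrite inE => /predU1P[->|/IHp/andP[u1 u2]].
  by rewrite /= !inE !eqxx orbT.
by rewrite !(in_cons x) u1 u2 !orbT.
Qed.

Lemma steps_map (A B : Type) (f : A -> B) x p :
  steps (f x) (map f p) = [seq (f u.1, f u.2) | u <- steps x p].
Proof. by elim: p x => [|y p IHp] x //=; rewrite IHp. Qed.

Lemma steps_iota x n : all (fun u => u.2 == u.1.+1) (steps x (iota x.+1 n)).
Proof. by elim: n x => [|n IHn] x //=; rewrite eqxx IHn. Qed.

Lemma last_iota x n : last x (iota x.+1 n) = x + n.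
Proof. by elim: n x => [|n IHn] x /=; rewrite ?addn0 // IHn addSnnS. Qed.

Notation chord := (nat * nat)%type.

Definition lt2 : rel chord := fun e f => (e.1 < f.1) && (e.2 < f.2).

Definition joined (M : seq chord) x p :=
  all (fun u => [|| u.2 == u.1.+1, u \in M | swap u \in M]) (steps x p).

Definition traverses (M : seq chord) x p :=
  all (fun e => (e \in steps x p) || (swap e \in steps x p)) M.

Lemma joined_sub (M N : seq chord) x p :
  joined M x p -> {subset M <= N} -> joined N x p.
Proof.
move=> jp sMN; move: jp; apply: sub_all => u /or3P[->//|/sMN->|/sMN->]; by rewrite ?orbT.
Qed.

Lemma joined_iota (M : seq chord) x n : joined M x (iota x.+1 n).
Proof. by apply: sub_all (steps_iota x n) => u ->. Qed.

Lemma joined_cons (M : seq chord) x y p :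
  joined M x (y :: p) =
  [|| y == x.+1, (x, y) \in M | (y, x) \in M] && joined M y p.
Proof. by []. Qed.

Lemma traverses_cons e (M : seq chord) x p :
  traverses (e :: M) x p =
  ((e \in steps x p) || (swap e \in steps x p)) && traverses M x p.
Proof. by []. Qed.

Lemma traverses_sub (M : seq chord) x p y q :
  traverses M x p -> {subset steps x p <= steps y q} -> traverses M y q.
Proof.
by move=> tp sub; move: tp; apply: sub_all => e /orP[] /sub ->; rewrite ?orbT.
Qed.

(* Chords of one block pairwise cross: all left ends precede the separator [u]
   and all right ends follow it.  Blocks have odd size because a zigzag through
   an even number of pairwise crossing chords ends on the wrong side. *)
Inductive zigzag : nat -> seq chord -> Prop :=
| zigzag_nil lo : zigzag lo [::]
| zigzag_block lo u B r :
    odd (size B) -> pairwise lt2 B ->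
    all (fun e => [&& lo <= e.1, e.1 < u & u <= e.2]) B ->
    zigzag (last (0, 0) B).2.+1 r -> zigzag lo (B ++ r).

(** Chords are consumed two at a time: [e] from left to right, a walk from [e.2] up to [f.2], [f]
    from right to left, a walk from [f.1] up to [g.1], then [g] recursively. Crossing keeps the
    visited intervals disjoint, and odd size makes the last chord end on the right side, where the
    route through [r] takes over. The bound [k] allows induction in steps of two. *)
Lemma block_route (m u : nat) (r : seq chord) (k : nat) (e : chord) B :
  size B <= k -> odd (size (e :: B)) -> pairwise lt2 (e :: B) ->
  all (fun f => [&& f.1 < u, u <= f.2 & f.2 < m]) (e :: B) ->
  (exists p,
    [/\ [/\ last (last e B).2 p = m.-1, uniq p
          & all (fun x => (last e B).2 < x < m) p],
        joined r (last e B).2 p & traverses r (last e B).2 p]) ->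
  exists p,
    [/\ [/\ last e.2 p = m.-1, uniq (e.2 :: p)
          & all (fun x => (e.1 < x < u) || (e.2 <= x < m)) (e.2 :: p)],
        joined (e :: B ++ r) e.1 (e.2 :: p)
      & traverses (e :: B ++ r) e.1 (e.2 :: p)].
Proof.
have one f : [&& f.1 < u, u <= f.2 & f.2 < m] ->
  (exists p,
    [/\ [/\ last f.2 p = m.-1, uniq p & all (fun x => f.2 < x < m) p],
        joined r f.2 p & traverses r f.2 p]) ->
  exists p,
    [/\ [/\ last f.2 p = m.-1, uniq (f.2 :: p)
          & all (fun x => (f.1 < x < u) || (f.2 <= x < m)) (f.2 :: p)],
        joined (f :: r) f.1 (f.2 :: p) & traverses (f :: r) f.1 (f.2 :: p)].
  move=> bnd [p [[lp up ap] jp tp]].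
  exists p; split.
  + split=> //=.
    * rewrite up andbT; apply/negP => /(allP ap); lia.
    * apply/andP; split; first lia.
      by apply: sub_all ap => x; lia.
  + rewrite joined_cons -surjective_pairing mem_head orbT /=.
    by apply: (joined_sub jp) => x; rewrite inE orbC => ->.
  + rewrite traverses_cons /= -surjective_pairing mem_head /=.
    by apply: (traverses_sub tp) => x xs; rewrite inE xs orbT.
elim: k e B => [|k IHk] e [|f [|g B]] // szB oddB.
- by move=> _; rewrite all_seq1; exact: one.
- by move=> _; rewrite all_seq1; exact: one.
- move=> pw bnd [p0 hp0].
  have [pwgB ef eg fg] : [/\ pairwise lt2 (g :: B), lt2 e f, lt2 e g & lt2 f g].
    by move: pw => /= /and3P[/and3P[-> -> _] /andP[-> _] ->].
  have bndgB : all (fun f => [&& f.1 < u, u <= f.2 & f.2 < m]) (g :: B).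
    by move: bnd => /= /and3P[].
  have oddgB : odd (size (g :: B)) by move: oddB => /=; rewrite !negbK.
  have [p' [[lp up ap] jp tp]] :=
    IHk g B (ltnW szB) oddgB pwgB bndgB
      (ex_intro _ p0 hp0).
  pose fits f := [&& f.1 < u, u <= f.2 & f.2 < m].
  have [be bf bg] : [/\ fits e, fits f & fits g].
    by move: bnd => /= /and4P[].
  rewrite /fits in be bf bg.
  move: ef eg fg => /andP[ef1 ef2] /andP[eg1 eg2] /andP[fg1 fg2].
  exists (iota e.2.+1 (f.2 - e.2) ++
          (f.1 :: iota f.1.+1 (g.1 - f.1)) ++ g.2 :: p').
  rewrite -cat_cons.
  have {}lp : last g.1 (g.2 :: p') = m.-1 := lp.
  move: (g.2 :: p') lp up ap jp tp => p lp up ap jp tp.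
  have lf : last e.1 (e.2 :: iota e.2.+1 (f.2 - e.2)) = f.2.
    by rewrite /= last_iota subnKC // ltnW.
  have lg : last f.1 (iota f.1.+1 (g.1 - f.1)) = g.1.
    by rewrite last_iota subnKC // ltnW.
  have mem4 x : x \in [:: e, f, g & B ++ r] = [|| x == e, x == f | x \in g :: B ++ r].
    by rewrite !inE.
  have stp : steps e.1 ((e.2 :: iota e.2.+1 (f.2 - e.2)) ++
          (f.1 :: iota f.1.+1 (g.1 - f.1)) ++ p) =
      ((e.1, e.2) :: steps e.2 (iota e.2.+1 (f.2 - e.2))) ++
      (f.2, f.1) :: steps f.1 (iota f.1.+1 (g.1 - f.1)) ++ steps g.1 p.
    by rewrite steps_cats lf /= steps_cats lg.
  split.
  + split.
    * by rewrite last_cat /= last_cat lg lp.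
    * rewrite cat_uniq; apply/and3P; split.
      - exact: (iota_uniq e.2 (f.2 - e.2).+1).
      - apply/hasPn => x; rewrite mem_cat !inE !mem_iota.
        by case/orP => [hx | /(allP ap) hx]; clear -ef1 ef2 eg1 eg2 fg1 fg2 be bf bg hx; lia.
      - rewrite cat_uniq up andbT (iota_uniq f.1 (g.1 - f.1).+1) /=.
        apply/hasPn => x /(allP ap) hx; rewrite inE mem_iota.
        by clear -ef1 ef2 eg1 eg2 fg1 fg2 be bf bg hx; lia.
    * rewrite !all_cat; apply/and3P; split.
      - by apply/allP => x; rewrite inE mem_iota => hx; clear -ef1 ef2 eg1 eg2 fg1 fg2 be bf bg hx; lia.
      - by apply/allP => x; rewrite inE mem_iota => hx; clear -ef1 ef2 eg1 eg2 fg1 fg2 be bf bg hx; lia.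
      - by apply: sub_all ap => x hx; clear -ef1 ef2 eg1 eg2 fg1 fg2 be bf bg hx; lia.
  + rewrite /joined stp /= all_cat /= all_cat -surjective_pairing mem4 eqxx orbT /=.
    apply/and4P; split.
    * exact: joined_iota.
    * by rewrite /swap /= -surjective_pairing !mem4 !eqxx !orbT.
    * exact: joined_iota.
    * by apply: (joined_sub jp) => x; rewrite mem4 => ->; rewrite !orbT.
  + rewrite /traverses stp /= -surjective_pairing mem_head /=.
    apply/andP; split.
      by apply/orP; right; rewrite /swap inE mem_cat inE eqxx !orbT.
    move: tp => /= /andP[tg tB]; apply/andP; split.
      by case/orP: tg => h; apply/orP; [left|right]; rewrite inE mem_cat inE mem_cat h !orbT.
    by apply: sub_all tB => x /orP[] h; apply/orP; [left|right];
      rewrite inE mem_cat inE mem_cat h !orbT.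
Qed.

(** The start [b] lies just before the range allowed by [lo]. Each block is entered by walking right
    from [b] and exited at its last right end, which is the start for the remaining blocks; after
    them the route walks on to [m.-1]. *)
Lemma zigzag_route (m lo : nat) (M : seq chord) :
  zigzag lo M -> all (fun e => e.2 < m) M ->
  forall b, lo = b.+1 -> b < m ->
  exists p,
    [/\ [/\ last b p = m.-1, uniq p & all (fun x => b < x < m) p],
        joined M b p & traverses M b p].
Proof.
elim=> {lo M} [lo | lo u B r oddB pwB bndB _ IHr] bndm b def_lo ltbm.
  exists (iota b.+1 (m.-1 - b)); split=> //; last exact: joined_iota.
  split; [by rewrite last_iota; lia | exact: iota_uniq |].
  by apply/allP => x; rewrite mem_iota; lia.
case: B => [|e B] // in oddB pwB bndB IHr bndm *.
rewrite all_cat in bndm; case/andP: bndm => bmB bmr.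
have inl : last e B \in e :: B by exact: mem_last.
have ltm : (last e B).2 < m by move/allP: bmB => /(_ _ inl).
have [||p' [[lp up ap] jp tp]] := @block_route m u r (size B) e B (leqnn _) oddB pwB.
- apply/allP => f fB; move/allP: bmB => /(_ _ fB).
  by move/allP: bndB => /(_ _ fB); lia.
- exact: (IHr bmr _ erefl ltm).
have {}lp : last e.1 (e.2 :: p') = m.-1 := lp.
move: (e.2 :: p') lp up ap jp tp => p lp up ap jp tp.
have he : [&& b < e.1, e.1 < u, u <= e.2 & e.2 < m].
  by move: bndB bmB => /= /andP[+ _] /andP[+ _]; lia.
have l1 : last b (iota b.+1 (e.1 - b)) = e.1.
  by rewrite last_iota subnKC // ltnW //; case/and4P: he.
have stp : steps b (iota b.+1 (e.1 - b) ++ p) = steps b (iota b.+1 (e.1 - b)) ++ steps e.1 p.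
  by rewrite steps_cats l1.
exists (iota b.+1 (e.1 - b) ++ p); split.
- split.
  + by rewrite last_cat l1.
  + rewrite cat_uniq up iota_uniq andbT /=; apply/hasPn => x /(allP ap) hx.
    by rewrite mem_iota; clear -he hx; lia.
  + rewrite all_cat; apply/andP; split.
      by apply/allP => x; rewrite mem_iota => hx; clear -he hx; lia.
    by apply: sub_all ap => x hx; clear -he hx; lia.
- by rewrite /joined stp all_cat; apply/andP; split; [exact: joined_iota | exact: jp].
- by apply: (traverses_sub tp) => x xs; rewrite stp mem_cat xs orbT.
Qed.

(** Blocks are cut off greedily and dealt in turn to three families. Blocks three places apart are
    separated: the earlier one ends before the right end of the head of its successor, and the third
    family of the rest lies beyond that end. The last two conclusions carry this through the
    induction. *)
Lemma chain_split (M : seq chord) :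
  pairwise lt2 M -> all (fun e => e.1 < e.2) M ->
  exists L1 L2 L3 : seq chord,
    [/\ [/\ zigzag 0 L1, zigzag 0 L2 & zigzag 0 L3],
        forall e, e \in M = [|| e \in L1, e \in L2 | e \in L3],
        {subset L2 <= behead M}
      & all (fun e => (head (0, 0) M).2 <= e.1) L3].
Proof.
have [k] := ubnP (size M); elim: k M => // k IHk [|e M].
  move=> _ _ _; exists [::], [::], [::]; split=> //; split; exact: zigzag_nil.
move=> szM pwM bndM.
pose t := find (fun f => e.2 <= f.1) M.
(* [b] is the largest even number of further chords crossing [e]. *)
pose b := t./2.*2.
have lebt : b <= t by rewrite /b; lia.
have letM : t <= size M := find_size _ _.
have ltb f : f \in take b M -> f.1 < e.2.
  move=> fb; have ib : index f M < b by exact: index_ltn.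
  have := before_find (0, 0) (a := fun f => e.2 <= f.1) (leq_trans ib lebt).
  by rewrite (nth_index _ (mem_take fb)) leqNgt => /negbFE.
have pwC : pairwise lt2 ((e :: take b M) ++ drop b M) by rewrite /= cat_take_drop.
have bndC : all (fun e => e.1 < e.2) ((e :: take b M) ++ drop b M).
  by rewrite /= cat_take_drop.
move: (pwC); rewrite pairwise_cat => /and3P[/allrelP sep pwB pwD].
move: (bndC); rewrite all_cat => /andP[bndB bndD].
have [|L1 [L2 [L3 [[z1 z2 z3] defM sub2 bnd3]]]] := IHk (drop b M) _ pwD bndD.
  by rewrite size_drop; apply: leq_ltn_trans (leq_subr _ _) _.
(* The families of the rest change places cyclically: its third continues the new block, its first
   becomes the second, and its second becomes the third. *)
exists ((e :: take b M) ++ L3), L1, L2; split.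
- split=> //.
  apply: (@zigzag_block 0 e.2).
  + by rewrite /= size_takel ?(leq_trans lebt) // /b odd_double.
  + exact: pwB.
  + apply/allP => f fB; move/allP: bndB => /(_ _ fB).
    move: fB; rewrite inE => /predU1P[->|fB]; first by rewrite leqnn andbT.
    move: pwM (ltb _ fB) => /= /andP[/allP/(_ _ (mem_take fB))/andP[_ h1] _] h2.
    by rewrite h2 (ltnW h1).
  + have -> : last (0, 0) (e :: take b M) = last e (take b M) by [].
    have lastlt f : f \in drop b M -> lt2 (last e (take b M)) f.
      by move=> fD; apply: sep => //; exact: mem_last.
    have all3 : all (fun f => (last e (take b M)).2 < f.1) L3.
      apply/allP => f f3; move/allP: bnd3 => /(_ _ f3).
      have : f \in drop b M by rewrite defM f3 !orbT.
      case: (drop b M) lastlt => [|g D] // /(_ g (mem_head _ _)) /andP[_ h1] _ /= h2.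
      exact: leq_trans h1 h2.
    (* Only the first block of [L3] carries the lower bound [0], and [all3] raises it. *)
    case: z3 all3 => [lo|lo u B r oB pB aB zr] all3; first exact: zigzag_nil.
    apply: (@zigzag_block _ u) => //.
    apply/allP => f fB; move/allP: aB => /(_ _ fB) /and3P[_ -> ->].
    by rewrite (allP all3) // mem_cat fB.
- move=> f; rewrite -[M in _ :: M](cat_take_drop b) -cat_cons !mem_cat defM.
  by case: (f \in L3); rewrite ?orbT ?orbF.
- by move=> f f1 /=; apply: mem_drop (_ : f \in drop b M); rewrite defM f1.
- apply/allP => f /sub2 f2 /=.
  (* At most one chord of [drop b M] precedes index [t], since [t - b <= 1]. It is the head, which
     [sub2] leaves out. *)
  have : f \in drop t M.
    rewrite -[drop b M](cat_take_drop (t - b)) in f2.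
    move: f2; rewrite drop_drop subnK //.
    case def1: (take (t - b) (drop b M)) => [|g D] /=; first exact: mem_behead.
    rewrite mem_cat => /orP[|//].
    have : size (take (t - b) (drop b M)) <= 1.
      rewrite size_take_min (leq_trans (geq_minl _ _)) // /b.
      by rewrite -{1}(odd_double_half t) addnK; case: odd.
    by rewrite def1; case: D {def1}.
  move=> fD.
  have hast : t < size M by move: fD; case: ltnP => // h; rewrite drop_oversize.
  have hf : e.2 <= (nth (0, 0) M t).1.
    by apply: (@nth_find _ _ (fun f => e.2 <= f.1)); rewrite has_find.
  move: fD; rewrite (drop_nth (0, 0)) // inE => /predU1P[->//|fD].
  have : pairwise lt2 (drop t M).
    by apply: subseq_pairwise (drop_subseq _ _) _; move: pwM => /= /andP[].
  rewrite (drop_nth (0, 0)) // pairwise_cons => /andP[/allP/(_ _ fD)/andP[h _] _].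
  exact: leq_trans hf (ltnW h).
Qed.

Lemma zigzag_cons_inv lo e (M : seq chord) :
  zigzag lo (e :: M) ->
  exists u B r,
    [/\ M = B ++ r, odd (size (e :: B)), pairwise lt2 (e :: B),
        all (fun f => [&& lo <= f.1, f.1 < u & u <= f.2]) (e :: B)
      & zigzag (last e B).2.+1 r].
Proof.
move def_L: (e :: M) => L z.
case: z def_L => [//|{}lo u [//|f B] r oB pB bB zr] [-> ->].
by exists u, B, r.
Qed.

(** * Crossing chords and frames of subdivided K4s on a closed line *)

Definition crosses : rel chord := fun e g =>
  (e.1 < g.1 < e.2) && (e.2 < g.2) || (g.1 < e.1 < g.2) && (g.2 < e.2).

(** These are the steps available when the line [0, ..., m.-1] is closed to a cycle by [(m.-1, 0)]
    and one extra chord [g] is added. *)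
Definition admissible m (g : chord) (M : seq chord) (u : chord) :=
  [|| u.2 == u.1.+1, u == (m.-1, 0), u \in M, swap u \in M, u == g
    | swap u == g].

Lemma joined_admissible m g (M N : seq chord) x p :
  joined M x p -> {subset M <= N} -> all (admissible m g N) (steps x p).
Proof.
move=> jp sMN; have := joined_sub jp sMN; apply: sub_all => u.
by rewrite /admissible => /or3P[] ->; rewrite ?orbT.
Qed.

Lemma iota_admissible m g M x n :
  all (admissible m g M) (steps x (iota x.+1 n)).
Proof. by apply: sub_all (steps_iota x n) => u; rewrite /admissible => ->. Qed.

Lemma closing_admissible m g M n :
  all (admissible m g M) (steps m.-1 (rcons (iota 0 n) n)).
Proof.
have -> : rcons (iota 0 n) n = 0 :: iota 1 n by rewrite -cats1 -(iotaD 0 n 1) addn1.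
by rewrite /= iota_admissible andbT /admissible eqxx orbT.
Qed.

Lemma rcons_iota x n : rcons (iota x n) (x + n) = iota x n.+1.
Proof. by rewrite -cats1 -(iotaD x n 1) addn1. Qed.

Lemma cons_interval a b : a < b -> a :: iota a.+1 (b - a.+1) = iota a (b - a).
Proof. by move=> ltab; rewrite [RHS]/(iota a _) -[b - a]prednK ?subn_gt0 // subnS. Qed.

Lemma cat_interval a b c :
  a <= b <= c -> iota a (b - a) ++ iota b (c - b) = iota a (c - a).
Proof.
move=> /andP[leab lebc]; rewrite -{2}(subnKC leab) -iotaD; congr iota; lia.
Qed.

Lemma all_cons (A : Type) (a : pred A) x s : all a (x :: s) = a x && all a s.
Proof. by []. Qed.

Lemma uniq_cat_pred (A : eqType) (P : pred A) (s t : seq A) :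
  uniq s -> all P s -> uniq t -> all (fun x => ~~ P x) t -> uniq (s ++ t).
Proof.
move=> us /allP Ps ut /allP Pt; rewrite cat_uniq us ut andbT /=.
by apply/hasPn => x /Pt; apply: contra => /Ps.
Qed.

(** A subdivision of $K_4$ with branch vertices [x1], ..., [x4]: the segments [s1], ..., [s4]
    complete a cycle through them, [q1] is the interior of a path from [x1] to [x3], and [q2] that
    of a path from [x2] to [x4]. *)
Definition frame (V : Type) (x1 x2 x3 x4 : V) s1 s2 s3 s4 q1 q2 :=
  (x1 :: s1 ++ x2 :: s2 ++ x3 :: s3 ++ x4 :: s4) ++ q1 ++ q2.

Definition frame_steps (V : Type) (x1 x2 x3 x4 : V) s1 s2 s3 s4 q1 q2 :=
  steps x1 (s1 ++ x2 :: s2 ++ x3 :: s3 ++ x4 :: rcons s4 x1) ++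
  steps x1 (rcons q1 x3) ++ steps x2 (rcons q2 x4).

(** The zigzag, closed through [m.-1] and [0], gives the cycle. If the first block is [e] alone, the
    cycle follows the line from [e.1] to [e.2], and [e] and [g] supply the two crossing paths.
    Otherwise the block begins with three chords [e], [f], [k], and the crossing paths are two line
    segments skipped by the cycle, from [e.1] to [f.1] and from [f.2] to [k.2]. *)
Lemma zigzag_frame m e (M : seq chord) g :
  zigzag 0 (e :: M) -> all (fun f => f.2 < m) (e :: M) ->
  g.1 < g.2 < m -> crosses e g ->
  exists x1 x2 x3 x4 s1 s2 s3 s4 q1 q2,
    [/\ uniq (frame x1 x2 x3 x4 s1 s2 s3 s4 q1 q2),
        all (fun x => x < m) (frame x1 x2 x3 x4 s1 s2 s3 s4 q1 q2),
        all (admissible m g (e :: M))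
          (frame_steps x1 x2 x3 x4 s1 s2 s3 s4 q1 q2)
      & all (fun f => (f \in frame_steps x1 x2 x3 x4 s1 s2 s3 s4 q1 q2) ||
                      (swap f \in frame_steps x1 x2 x3 x4 s1 s2 s3 s4 q1 q2))
          (e :: M)].
Proof.
move=> /zigzag_cons_inv[u [B [r [-> oddB pwB bndB zr]]]] bndm gm cross_eg.
case: B => [|f [|k B]] // in oddB pwB bndB zr bndm *.
- move: bndB bndm zr; rewrite cat0s all_seq1 => bndB /andP[em bndr] zr.
  have [p [[lp up ap] jp tp]] := zigzag_route zr bndr erefl em.
  (* [x] is the end of [g] under [e], and [y] is the other end. *)
  have [x [y [xin yout gxy]]] : exists x y,
      [/\ e.1 < x < e.2, (y < e.1) || (e.2 < y < m)
        & ((x, y) == g) || ((y, x) == g)].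
    case/orP: cross_eg => hc; [exists g.1, g.2 | exists g.2, g.1];
      split; rewrite -?surjective_pairing ?eqxx ?orbT //; clear -hc gm; lia.
  pose R := p ++ iota 0 e.1.
  (* The cycle may skip [y], so the path through [g] continues along the line to the first point [z]
     of the cycle from [y] on. For [y] beyond [e.2], the point [m.-1] shows that one exists. *)
  have exz : exists z, (z \in R) && (y <= z).
    case/orP: yout => hy; first by exists y; rewrite leqnn mem_cat mem_iota hy orbT.
    exists m.-1; rewrite mem_cat.
    have -> : m.-1 \in p.
      case: (p) lp => [/=|z q /= <-]; last exact: mem_last.
      by clear -hy; lia.
    by clear -hy; lia.
  have [z /andP[zR yz] minz] := ex_minnP exz.
  have apz v : v \in p -> e.2 < v < m by move/(allP ap).
  have uR : uniq R.
    rewrite cat_uniq up iota_uniq andbT /=; apply/hasPn => v.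
    by rewrite mem_iota => hv; apply/negP => /apz; clear -hv xin; lia.
  have Rm v : v \in R -> (e.2 < v < m) || (v < e.1).
    rewrite mem_cat mem_iota => /orP[/apz->//|hv]; apply/orP; right.
    by clear -hv; lia.
  have zy : (e.2 < y < m) || (z == y).
    case/orP: yout => [hy|-> //]; rewrite eqn_leq yz minz ?orbT //.
    by rewrite leqnn mem_cat mem_iota hy orbT.
  have zm := Rm _ zR.
  have [R1 [R2 defR]] : exists R1 R2, R = R1 ++ z :: R2.
    by case/splitPr: zR => R1 R2; exists R1, R2.
  (* [e] joins its ends directly, so [q1] is empty; [q2] runs from [y] to just before [z] and is
     empty if [z = y]. *)
  exists e.1, x, e.2, z, (iota e.1.+1 (x - e.1.+1)), (iota x.+1 (e.2 - x.+1)),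
    R1, R2, [::], (iota y (z - y)).
  have inner : iota e.1.+1 (x - e.1.+1) ++ x :: iota x.+1 (e.2 - x.+1) ++ [:: e.2]
      = iota e.1.+1 (e.2 - e.1).
    case/andP: xin => ex xe.
    rewrite -cat_cons (cons_interval xe) catA.
    rewrite cat_interval; last by rewrite ex ltnW.
    have := @cat_interval e.1.+1 e.2 e.2.+1; rewrite subSS subSnn; apply.
    by rewrite (ltn_trans ex xe) leqnSn.
  have defF s : (iota e.1.+1 (x - e.1.+1)) ++ x :: (iota x.+1 (e.2 - x.+1)) ++ e.2 :: s
      = iota e.1.+1 (e.2 - e.1) ++ s.
    by rewrite -inner -!catA /= -!catA.
  have le2 : last e.1 (iota e.1.+1 (e.2 - e.1)) = e.2.
    by rewrite last_iota subnKC //; clear -xin; lia.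
  have stR : steps e.1 (iota e.1.+1 (x - e.1.+1) ++ x :: iota x.+1 (e.2 - x.+1) ++
      e.2 :: R1 ++ z :: rcons R2 e.1) =
      steps e.1 (iota e.1.+1 (e.2 - e.1)) ++ steps e.2 p ++
      steps m.-1 (rcons (iota 0 e.1) e.1).
    rewrite defF -rcons_cons -rcons_cat -defR /R rcons_cat.
    by rewrite steps_cats le2 steps_cats lp.
  have stq : rcons (iota y (z - y)) z = iota y (z - y).+1.
    by rewrite -{2}(subnKC yz) rcons_iota.
  pose I := iota e.1 (e.2 - e.1).+1.
  have memI v : (v \in I) = (e.1 <= v <= e.2).
    by rewrite mem_iota; clear -xin; lia.
  have uI : uniq I by exact: iota_uniq.
  have frameE : frame e.1 x e.2 z (iota e.1.+1 (x - e.1.+1))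
      (iota x.+1 (e.2 - x.+1)) R1 R2 [::] (iota y (z - y)) =
      (I ++ R) ++ iota y (z - y).
    by rewrite /frame defF -defR.
  clearbody I R.
  split.
  + rewrite frameE cat_uniq iota_uniq andbT; apply/andP; split.
      rewrite cat_uniq uI uR andbT /=; apply/hasPn => v /Rm hv.
      by rewrite memI; clear -xin hv; lia.
    apply/hasPn => v; rewrite mem_iota mem_cat subnKC // => /andP[yv vz].
    rewrite negb_or memI; apply/andP; split.
      by case/orP: zy => [hy|/eqP hy]; clear -hy yv vz xin; lia.
    by apply/negP => vR; have := minz v; rewrite vR yv leqNgt vz => /(_ isT).
  + rewrite frameE !all_cat -andbA; apply/and3P; split.
    * by apply/allP => v; rewrite memI => hv; clear -hv xin em; lia.
    * by apply/allP => v /Rm hv; clear -hv xin em; lia.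
    * apply/allP => v; rewrite mem_iota subnKC // => hv.
      by clear -hv zm xin em; lia.
  + rewrite /frame_steps stR stq !all_cat iota_admissible closing_admissible /=.
    rewrite (joined_admissible _ _ jp) ?iota_admissible /=; last first.
      by move=> h; rewrite inE orbC => ->.
    rewrite andbT {1 2}/admissible -surjective_pairing !mem_head !orbT /=.
    by case/orP: gxy => /eqP <-; rewrite /swap /= eqxx !orbT.
  + rewrite /frame_steps stR /=; apply/andP; split.
      by rewrite !mem_cat /= -surjective_pairing mem_head !orbT.
    by apply: sub_all tp => h /orP[] hs; rewrite !mem_cat hs ?orbT.
- have [pwkB ef fk] : [/\ pairwise lt2 (k :: B), lt2 e f & lt2 f k].
    by move: pwB => /= /and3P[/and3P[-> _ _] /andP[-> _] ->].
  have inB h : h \in [:: e, f, k & B] -> [&& h.1 < u, u <= h.2 & h.2 < m].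
    move=> h4; move/allP: bndB => /(_ _ h4) /and3P[_ -> ->] /=.
    by move/allP: bndm; apply; rewrite -cat_cons mem_cat h4.
  have bndkB : all (fun h => [&& h.1 < u, u <= h.2 & h.2 < m]) (k :: B).
    by apply/allP => h hkB; apply: inB; rewrite in_cons in_cons hkB !orbT.
  have oddkB : odd (size (k :: B)) by move: oddB => /=; rewrite !negbK.
  have bndr : all (fun h => h.2 < m) r.
    by apply/allP => h hr; move/allP: bndm; apply; rewrite -cat_cons mem_cat hr orbT.
  have lm : (last k B).2 < m.
    by move/allP: bndkB => /(_ _ (mem_last _ _)) /and3P[].
  have [p [[lp up ap] jp tp]] := block_route (leqnn _) oddkB pwkB bndkB
    (zigzag_route zr bndr erefl lm).
  have fe : [&& e.1 < u, u <= e.2 & e.2 < m] := inB e (mem_head _ _).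
  have [ff fk'] : [&& f.1 < u, u <= f.2 & f.2 < m] /\
      [&& k.1 < u, u <= k.2 & k.2 < m].
    by split; apply: inB; rewrite !inE eqxx ?orbT.
  move: ef fk => /andP[ef1 ef2] /andP[fk1 fk2].
  pose I1 := iota e.2 (f.2 - e.2).+1; pose I2 := iota f.1 (k.1 - f.1).+1.
  pose I0 := iota 0 e.1; pose P := k.2 :: p.
  pose J1 := iota e.1.+1 (f.1 - e.1.+1); pose J2 := iota f.2.+1 (k.2 - f.2.+1).
  have AI1 : all (fun v => e.2 <= v <= f.2) I1.
    by apply/allP => v; rewrite mem_iota => hv; clear -hv ef1 ef2 fk1 fk2 fe ff fk'; lia.
  have AI2 : all (fun v => f.1 <= v <= k.1) I2.
    by apply/allP => v; rewrite mem_iota => hv; clear -hv ef1 ef2 fk1 fk2 fe ff fk'; lia.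
  have AI0 : all (fun v => v < e.1) I0.
    by apply/allP => v; rewrite mem_iota.
  have AJ1 : all (fun v => e.1 < v < f.1) J1.
    by apply/allP => v; rewrite mem_iota => hv; clear -hv ef1 ef2 fk1 fk2 fe ff fk'; lia.
  have AJ2 : all (fun v => f.2 < v < k.2) J2.
    by apply/allP => v; rewrite mem_iota => hv; clear -hv ef1 ef2 fk1 fk2 fe ff fk'; lia.
  have AP : all (fun v => (k.1 < v < u) || (k.2 <= v < m)) P by exact: ap.
  have defI1 s : iota e.2 (f.2 - e.2) ++ f.2 :: s = I1 ++ s.
    rewrite -cat_rcons -[in rcons _ f.2](@subnKC e.2 f.2) ?(ltnW ef2) // addKn.
    by rewrite rcons_iota.
  (* The cycle passes from [f.2] to [f.1] along [f] itself, so [s2] is empty; [J1] and [J2] are the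
     skipped segments. *)
  exists e.1, f.2, f.1, k.2, (iota e.2 (f.2 - e.2)), [::],
    (iota f.1.+1 (k.1 - f.1)), (p ++ I0), J1, J2.
  have frameE : frame e.1 f.2 f.1 k.2 (iota e.2 (f.2 - e.2)) [::]
      (iota f.1.+1 (k.1 - f.1)) (p ++ I0) J1 J2 =
      [:: e.1] ++ I1 ++ I2 ++ P ++ I0 ++ J1 ++ J2.
    by rewrite /frame cat0s defI1 /I2 /P /= -!catA /= -!catA /= -!catA.
  have stE : frame_steps e.1 f.2 f.1 k.2 (iota e.2 (f.2 - e.2)) [::]
      (iota f.1.+1 (k.1 - f.1)) (p ++ I0) J1 J2 =
      ((e.1, e.2) :: steps e.2 (iota e.2.+1 (f.2 - e.2)) ++ (f.2, f.1) ::
        steps f.1 (iota f.1.+1 (k.1 - f.1)) ++ steps k.1 P ++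
        steps m.-1 (rcons (iota 0 e.1) e.1)) ++
      steps e.1 (rcons J1 f.1) ++ steps f.2 (rcons J2 k.2).
    rewrite /frame_steps cat0s defI1 rcons_cat; congr (_ ++ _).
    rewrite steps_cats /= last_iota (subnKC (ltnW ef2)); congr (_ :: _ ++ _ :: _).
    rewrite steps_cats last_iota (subnKC (ltnW fk1)) -cat_cons steps_cats.
    by rewrite /= lp.
  split.
  + have uP : uniq P by exact: up.
    have uI0 : uniq I0 := iota_uniq _ _.
    have [uI1 uI2] : uniq I1 /\ uniq I2 by split; apply: iota_uniq.
    have [uJ1 uJ2] : uniq J1 /\ uniq J2 by split; apply: iota_uniq.
    rewrite frameE; clearbody I1 I2 I0 P J1 J2.
    (* The seven pieces occupy disjoint ranges of positions; each is split off by a predicate that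
       holds on it and fails on all later pieces. *)
    apply: (@uniq_cat_pred _ (fun v => v == e.1));
      [by [] | by rewrite /= eqxx | | by rewrite !all_cat; do !(apply/andP; split);
        (apply: sub_all AI1 || apply: sub_all AI2 || apply: sub_all AI0 || apply: sub_all AP || apply: sub_all AJ1 || apply: sub_all AJ2) => v hv /=; clear -hv ef1 ef2 fk1 fk2 fe ff fk'; lia].
    apply: (@uniq_cat_pred _ (fun v => e.2 <= v <= f.2)) => //;
      [|by rewrite !all_cat; do !(apply/andP; split);
        (apply: sub_all AI1 || apply: sub_all AI2 || apply: sub_all AI0 || apply: sub_all AP || apply: sub_all AJ1 || apply: sub_all AJ2) => v hv /=; clear -hv ef1 ef2 fk1 fk2 fe ff fk'; lia].
    apply: (@uniq_cat_pred _ (fun v => f.1 <= v <= k.1)) => //;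
      [|by rewrite !all_cat; do !(apply/andP; split);
        (apply: sub_all AI1 || apply: sub_all AI2 || apply: sub_all AI0 || apply: sub_all AP || apply: sub_all AJ1 || apply: sub_all AJ2) => v hv /=; clear -hv ef1 ef2 fk1 fk2 fe ff fk'; lia].
    apply: (@uniq_cat_pred _ (fun v => (k.1 < v < u) || (k.2 <= v < m))) => //;
      [|by rewrite !all_cat; do !(apply/andP; split);
        (apply: sub_all AI1 || apply: sub_all AI2 || apply: sub_all AI0 || apply: sub_all AP || apply: sub_all AJ1 || apply: sub_all AJ2) => v hv /=; clear -hv ef1 ef2 fk1 fk2 fe ff fk'; lia].
    apply: (@uniq_cat_pred _ (fun v => v < e.1)) => //;
      [|by rewrite !all_cat; do !(apply/andP; split);
        (apply: sub_all AI1 || apply: sub_all AI2 || apply: sub_all AI0 || apply: sub_all AP || apply: sub_all AJ1 || apply: sub_all AJ2) => v hv /=; clear -hv ef1 ef2 fk1 fk2 fe ff fk'; lia].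
    apply: (@uniq_cat_pred _ (fun v => e.1 < v < f.1)) => //.
    by apply: sub_all AJ2 => v hv /=; clear -hv ef1 ef2 fk1 fk2 fe ff fk'; lia.
  + rewrite frameE; clearbody I1 I2 I0 P J1 J2.
    rewrite !all_cat all_seq1; do !(apply/andP; split); first (clear -ef1 ef2 fk1 fk2 fe ff fk'; lia);
      (apply: sub_all AI1 || apply: sub_all AI2 || apply: sub_all AI0 || apply: sub_all AP || apply: sub_all AJ1 || apply: sub_all AJ2) => v hv /=; clear -hv ef1 ef2 fk1 fk2 fe ff fk'; lia.
  + have sub3 : {subset k :: B ++ r <= [:: e, f & (k :: B) ++ r]}.
      by move=> h hk; rewrite in_cons in_cons [h \in _ ++ _]hk !orbT.
    have chain x y n : x < y -> n = y - x.+1 ->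
        all (admissible m g [:: e, f & (k :: B) ++ r])
          (steps x (rcons (iota x.+1 n) y)).
      move=> xy ->; rewrite -{2}(subnKC xy) rcons_iota.
      exact: iota_admissible.
    rewrite stE !all_cat all_cons !all_cat all_cons !all_cat.
    rewrite !iota_admissible closing_admissible (joined_admissible _ _ jp sub3).
    rewrite !chain //.
    rewrite !andbT; apply/andP; split.
      by rewrite /admissible -surjective_pairing mem_head !orbT.
    by rewrite /admissible /swap -surjective_pairing !in_cons eqxx !orbT.
  + rewrite stE; set A := (_ ++ _).
    have sA s : s \in [:: (e.1, e.2); (f.2, f.1)] -> s \in A.
      move=> hs; rewrite /A mem_cat in_cons mem_cat in_cons.
      by move: hs; rewrite in_cons mem_seq1 => /orP[] ->; rewrite ?orbT.
    have sP s : s \in steps k.1 P -> s \in A.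
      move=> hs; rewrite /A mem_cat in_cons mem_cat in_cons !mem_cat hs.
      by rewrite !orbT.
    clearbody A; rewrite cat_cons all_cons all_cons; apply/and3P; split.
    * by apply/orP; left; apply: sA; rewrite -surjective_pairing mem_head.
    * by apply/orP; right; apply: sA; rewrite !inE eqxx orbT.
    * by apply: sub_all tp => h /orP[] /sP ->; rewrite ?orbT.
Qed.

(** * Subdivisions of the complete graph on four vertices *)

Definition trail (T : finType) (x : T) (p : seq T) : {set {set T}} :=
  [set:: [seq [set u.1; u.2] | u <- steps x p]].

Lemma trail_cat (T : finType) (x : T) p y q :
  trail x (p ++ y :: q) = trail x (rcons p y) :|: trail y q.
Proof.
rewrite /trail -cats1 !steps_cat /=; apply/setP => e.
by rewrite !inE !map_cat !mem_cat /= !inE orbA.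
Qed.

Lemma trail_cons (T : finType) (x : T) y q :
  trail x (y :: q) = [set x; y] |: trail y q.
Proof. by apply/setP => e; rewrite !inE. Qed.

(** Applied with new interior vertices [p]: an edge of the subdivided path is either the replaced
    edge or contains a new vertex, so it differs from every other old edge. *)
Lemma trail_rcons (T : finType) (x : T) p y e :
  e \in trail x (rcons p y) -> e = [set x; y] \/ exists2 z, z \in p & z \in e.
Proof.
elim: p x => [|z p IHp] x; first by rewrite !inE => /eqP; left.
rewrite rcons_cons trail_cons 2!inE => /orP[/eqP->|/IHp[->|[w wp we]]]; right.
- by exists z; rewrite ?mem_head // !inE eqxx orbT.
- by exists z; rewrite ?mem_head // !inE eqxx.
- by exists w; rewrite // inE wp orbT.
Qed.

Lemma graph_edge (T : finType) (G : graph T) e :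
  e \in edges G -> #|e| = 2 /\ e \subset vertices G.
Proof.
by case: G => -[V E] ax /(forall_inP ax) /andP[/eqP].
Qed.

Lemma set2_inj (T : finType) (a : T) : injective (fun b => [set a; b]).
Proof.
move=> b c /setP eq_bc; move: (eq_bc b) (eq_bc c).
by rewrite !inE !eqxx !orbT => /esym/orP[/eqP->|/eqP//] /orP[|] /eqP.
Qed.

(** This inverts a suppression: [z] has exactly the neighbors [x] and [y], which are nonadjacent
    once their edge is removed. *)
Lemma subdivide_edge (T U : finType) (H : graph U) (F : graph T) (x y z : T) :
  subdivision H F -> [set x; y] \in edges F -> z \notin vertices F ->
  exists F' : graph T,
    [/\ subdivision H F', vertices F' = z |: vertices F
      & edges F' = [set x; z] |: ([set z; y] |: edges F :\ [set x; y])].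
Proof.
move=> subF Fxy zF; have [cxy sxy] := graph_edge Fxy.
have xF : x \in vertices F by apply: (subsetP sxy); rewrite !inE eqxx.
have yF : y \in vertices F by apply: (subsetP sxy); rewrite !inE eqxx orbT.
have xz : x != z by apply: contraNneq zF => <-.
have zy : z != y by apply: contraNneq zF => ->.
have zNe e : e \in edges F -> z \notin e.
  by case/graph_edge => _ /subsetP se; apply: contra zF => /se.
have ax : graph_axiom (z |: vertices F,
    [set x; z] |: ([set z; y] |: edges F :\ [set x; y])).
  apply/forall_inP => e /=; rewrite !inE => /or3P[/eqP->|/eqP->|/andP[_ Fe]].
  - by rewrite cards2 xz; apply/subsetP => v; rewrite !inE => /orP[]/eqP->;
      rewrite ?eqxx ?xF ?orbT.
  - by rewrite cards2 zy; apply/subsetP => v; rewrite !inE => /orP[]/eqP->;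
      rewrite ?eqxx ?yF ?orbT.
  - have [-> se] := graph_edge Fe; rewrite eqxx /=.
    by apply: subset_trans se (subsetUr _ _).
exists (Graph ax); split=> //.
have adjz v : adj (Graph ax) z v = (v \in [set x; y]).
  rewrite /adj /edges /= !inE [[set x; z]]setUC !(inj_eq (@set2_inj _ z)).
  case Fzv: (_ \in edges F); last by rewrite andbF orbF.
  by have := zNe _ Fzv; rewrite !inE eqxx.
have nz : neighbors (Graph ax) z = [set x; y].
  by apply/setP => v; rewrite inE adjz.
apply: subdivision_suppression subF; exists z, x, y; split.
- by rewrite /vertices /= !inE eqxx.
- by rewrite /degree nz.
- rewrite /adj /edges /= !inE eqxx /= orbF negb_or; apply/andP; split.
    by rewrite (inj_eq (@set2_inj _ x)); apply: contraNneq zy => ->.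
  by rewrite [[set z; y]]setUC [[set x; y]]setUC (inj_eq (@set2_inj _ y)).
- apply/setP => v; rewrite /vertices /= !inE.
  by case: eqVneq => //= ->; apply/negbTE.
- apply/setP => e; rewrite /edges /= !inE.
  case: (eqVneq e [set x; y]) => [->|exy] //=.
  case Fe: (e \in edges F); first by rewrite !orbT zNe.
  rewrite orbF; case: eqVneq => [->|_] /=; first by rewrite !inE eqxx orbT.
  by case: eqVneq => //= ->; rewrite !inE eqxx.
Qed.

(** Interior vertices are inserted one at a time, always into the edge from the newest vertex to
    [y]; [E] holds all other edges. *)
Lemma subdivide_path (T U : finType) (H : graph U) (F : graph T) x p y E :
  subdivision H F -> edges F = [set x; y] |: E -> [set x; y] \notin E ->
  uniq p -> all [predC vertices F] p ->
  exists F' : graph T,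
    [/\ subdivision H F', vertices F' = vertices F :|: [set:: p]
      & edges F' = trail x (rcons p y) :|: E].
Proof.
elim: p x F E => [|z p IHp] x F E subF edF xyE.
  move=> _ _; exists F; rewrite trail_cons; split=> //.
    by apply/setP => v; rewrite !inE orbF.
  by rewrite edF; apply/setP => e; rewrite !inE orbF.
move=> /andP[zp up] /andP[/= zF pF].
have [||F1 [sub1 V1 E1]] := @subdivide_edge _ _ _ F x y z subF.
- by rewrite edF !inE eqxx.
- exact: zF.
have zNe e : e \in edges F -> z \notin e.
  by case/graph_edge => _ /subsetP se; apply: contra zF => /se.
have [|||F' [sub' V' E']] := IHp z F1 ([set x; z] |: E) sub1 _ _ up.
- rewrite E1 edF; apply/setP => e; rewrite !inE.
  case: (eqVneq e [set x; y]) => [->|_] /=; last by rewrite orbCA.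
  by rewrite (negbTE xyE) orbCA.
- rewrite !inE negb_or; apply/andP; split.
    rewrite [[set x; z]]setUC (inj_eq (@set2_inj _ z)) eq_sym.
    have /graph_edge[+ _] : [set x; y] \in edges F by rewrite edF !inE eqxx.
    by rewrite cards2; case: eqVneq.
  by apply/negP => Ezy; have := @zNe [set z; y]; rewrite edF !inE Ezy eqxx orbT => /(_ isT).
- apply/allP => v vp; rewrite inE V1 !inE negb_or (allP pF) // andbT.
  by apply: contraNneq zp => <-.
exists F'; split=> //.
  by rewrite V' V1; apply/setP => v; rewrite !inE -!orbA orbCA.
by rewrite E' /= trail_cons; apply/setP => e; rewrite !inE -!orbA orbCA.
Qed.

Section Links.

Variable T : finType.
Implicit Types (k : T * T * seq T) (l : seq (T * T * seq T)).

(** A triple [(x, y, p)] stands for an edge from [x] to [y] that is to be replaced by a path with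
    interior [p]. *)
Definition ends k := [set k.1.1; k.1.2].
Definition link k := trail k.1.1 (rcons k.2 k.1.2).

(** The links are subdivided in turn, and [E] gathers the finished ones. Since their interiors are
    new, a finished link shares no edge with those still waiting. *)
Lemma subdivide_links (U : finType) (H : graph U) l (F : graph T) E :
  subdivision H F -> edges F = [set:: map ends l] :|: E ->
  uniq (map ends l) -> all [predC E] (map ends l) ->
  uniq (flatten [seq k.2 | k <- l]) ->
  all [predC vertices F] (flatten [seq k.2 | k <- l]) ->
  exists F' : graph T,
    [/\ subdivision H F', vertices F' = vertices F :|: [set:: flatten [seq k.2 | k <- l]]
      & edges F' = \bigcup_(k <- l) link k :|: E].
Proof.
elim: l F E => [|k l IHl] F E subF edF.
  move=> _ _ _ _; exists F; rewrite big_nil; split=> //.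
  by apply/setP => v; rewrite !inE orbF.
rewrite [map ends _]/= [flatten _]/= => /andP[kl ul] /andP[kE lE].
rewrite cat_uniq all_cat => /and3P[uk kl' ufl] /andP[kF lF].
have [||F1 [sub1 V1 E1]] :=
  @subdivide_path _ _ _ F k.1.1 k.2 k.1.2 ([set:: map ends l] :|: E) subF _ _ uk kF.
- by rewrite edF; apply/setP => e; rewrite !inE orbA.
- by rewrite !inE negb_or kl.
have [|||F' [sub' V' E']] := IHl F1 (link k :|: E) sub1 _ ul _ ufl.
- by rewrite E1; apply/setP => e; rewrite /link !inE orbCA.
- apply/allP => e el; rewrite /= in_setU negb_or [e \notin E](allP lE) // andbT.
  apply/negP => /trail_rcons[eq_e|[z zk ze]]; first by rewrite -/(ends k) in eq_e; rewrite -eq_e el in kl.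
  have /graph_edge[_ /subsetP/(_ _ ze)] : e \in edges F by rewrite edF !inE el orbT.
  by apply/negP; apply: (allP kF).
- apply/allP => v vl; rewrite inE V1 !inE negb_or [v \notin vertices F](allP lF) //=.
  by apply: contra kl' => vk; apply/hasP; exists v.
exists F'; split=> //.
  by rewrite V' V1; apply/setP => v; rewrite !inE mem_cat orbA.
by rewrite E' big_cons; apply/setP => e; rewrite !inE -!orbA orbCA.
Qed.

End Links.

(** Any bijection of the vertex sets is an isomorphism here; the one used matches enumeration
    ranks. *)
Lemma complete_on (T : finType) (V : {set T}) (k : nat) :
  #|V| = k ->
  exists F : graph T,
    [/\ subdivision (complete_graph k) F, vertices F = V
      & edges F = [set e : {set T} | e \subset V & #|e| == 2]].
Proof.
move=> cV.
have ax : graph_axiom (V, [set e : {set T} | e \subset V & #|e| == 2]).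
  by apply/forall_inP => e; rewrite inE /= => /andP[-> ->].
exists (Graph ax); split=> //; apply: subdivision_iso.
have cards : #|{: {x : T | x \in vertices (Graph ax)}}| =
    #|{: {y : 'I_k | y \in vertices (complete_graph k)}}|.
  by rewrite !card_sig cardsT card_ord.
exists (fun u => enum_val (cast_ord cards (enum_rank u))); split.
  exists (fun w => enum_val (cast_ord (esym cards) (enum_rank w))) => u.
    by rewrite enum_valK cast_ordK enum_rankK.
  by rewrite enum_valK cast_ordKV enum_rankK.
move=> x y; rewrite /adj /edges /= !inE !cards2.
have -> : [set val x; val y] \subset V.
  by apply/subsetP => v; rewrite !inE => /orP[]/eqP->; apply: valP.
by rewrite !(inj_eq val_inj) (inj_eq enum_val_inj) (inj_eq (@cast_ord_inj _ _ _)) (inj_eq enum_rank_inj).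
Qed.

(** Start from the complete graph on [x1], ..., [x4] and subdivide its six edges, four into the
    cycle and two into the crossing paths. *)
Lemma K4_cycle_crossing_paths (T : finType) (x1 x2 x3 x4 : T) s1 s2 s3 s4 q1 q2 :
  uniq ((x1 :: s1 ++ x2 :: s2 ++ x3 :: s3 ++ x4 :: s4) ++ q1 ++ q2) ->
  exists F : graph T,
    [/\ subdivision (complete_graph 4) F,
        vertices F = [set:: (x1 :: s1 ++ x2 :: s2 ++ x3 :: s3 ++ x4 :: s4) ++ q1 ++ q2]
      & edges F = trail x1 (s1 ++ x2 :: s2 ++ x3 :: s3 ++ x4 :: rcons s4 x1) :|:
          trail x1 (rcons q1 x3) :|: trail x2 (rcons q2 x4)].
Proof.
pose X := [:: x1; x2; x3; x4].
pose l := [:: (x1, x2, s1); (x2, x3, s2); (x3, x4, s3); (x4, x1, s4);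
  (x1, x3, q1); (x2, x4, q2)].
pose fl := flatten [seq k.2 | k <- l].
set al := (_ ++ q1 ++ q2) => ual.
have perm_al : perm_eq al (X ++ fl).
  rewrite /al /X /fl /= cats0; apply/permP => a.
  by do 6!rewrite ?count_cat /=; lia.
have : uniq (X ++ fl) by rewrite -(perm_uniq perm_al).
rewrite cat_uniq => /and3P[uX Xfl ufl].
have cX : #|[set:: X]| = 4 by rewrite cardsE (card_uniqP uX).
have [F [subF VF EF]] := complete_on cX.
have EF6 : edges F = [set:: map (@ends T) l].
  rewrite EF; apply/setP => e; rewrite !inE; apply/idP/idP.
    case/andP => /subsetP sub /cards2P[a [b [ab def_e]]].
    have := sub a; have := sub b; rewrite def_e !inE !eqxx orbT => /(_ isT) hb /(_ isT) ha.
    rewrite /ends /=.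
    case/or4P: ha ab => /eqP->; case/or4P: hb => /eqP->; rewrite ?eqxx // => _;
      rewrite ?eqxx ?orbT //; rewrite setUC ?eqxx ?orbT //.
  move: uX; rewrite /= !inE !negb_or -!andbA => /and5P[n12 n13 n14 n23 /and3P[n24 n34 _]].
  rewrite /ends /= => ee; apply/andP; split; last first.
    by repeat case/orP: ee => ee; rewrite (eqP ee) cards2 ?(eq_sym x4 x1) ?n12 ?n13 ?n14 ?n23 ?n24 ?n34.
  apply/subsetP => v ve; rewrite !inE.
  by repeat case/orP: ee => ee; move: ve; rewrite (eqP ee) !inE => /orP[] ->; rewrite ?orbT.
(* The six listed edges are distinct because together they make up all six pairs of a set of four
   vertices. *)
have ul : uniq (map (@ends T) l).
  by apply/card_uniqP; rewrite -cardsE -EF6 EF cards_draws cX.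
have [|||F' [sub' V' E']] := @subdivide_links T _ _ l F set0 subF _ ul _ ufl.
- by rewrite setU0.
- by apply/allP => e _; rewrite !inE.
- apply/allP => v vfl; rewrite inE VF inE; apply: contra Xfl => vX.
  by apply/hasP; exists v.
exists F'; split=> //.
  rewrite V' VF; apply/setP => v.
  have in_seq (s : seq T) : (v \in [set:: s]) = (v \in s) by rewrite inE.
  by rewrite in_setU !in_seq (perm_mem perm_al) [RHS]mem_cat.
rewrite E' setU0 !big_cons big_nil /link /= setU0 !trail_cat.
by rewrite !setUA.
Qed.

(** * From positions on a cycle to its vertices *)

Section Lift.

Variables (T : finType) (x0 : T) (c : seq T).

Definition span (f : chord) : {set T} := [set nth x0 c f.1; nth x0 c f.2].

Definition rim i := span (i, i.+1 %% size c).

Lemma span_swap f : span (swap f) = span f.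
Proof. by rewrite /span setUC. Qed.

Lemma trail_map x p :
  trail (nth x0 c x) (map (nth x0 c) p) = [set:: map span (steps x p)].
Proof. by rewrite /trail steps_map -map_comp. Qed.

(** [nth x0 c] is injective on positions, so it carries the frame of a zigzag to a subdivision in
    the graph. The list of possible edges is what later shows which chords the subdivision omits. *)
Lemma K4_zigzag e (M : seq chord) g :
  uniq c -> zigzag 0 (e :: M) -> all (fun f => f.2 < size c) (e :: M) ->
  g.1 < g.2 < size c -> crosses e g ->
  exists F : graph T,
    [/\ subdivision (complete_graph 4) F, {subset vertices F <= c},
        forall f, f \in e :: M -> span f \in edges F
      & forall E, E \in edges F ->
          [\/ exists2 i, i < size c & E = rim i, E = span g
            | exists2 f, f \in e :: M & E = span f]].
Proof.
move=> uc zz bnd gm ceg.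
have [x1 [x2 [x3 [x4 [s1 [s2 [s3 [s4 [q1 [q2 [uF mF aF tF]]]]]]]]]]] :=
  zigzag_frame zz bnd gm ceg.
pose v := nth x0 c.
have inj_v : {in frame x1 x2 x3 x4 s1 s2 s3 s4 q1 q2 &, injective v}.
  move=> i j /(allP mF) im /(allP mF) jm /eqP.
  by rewrite nth_uniq // => /eqP.
have frame_map : map v (frame x1 x2 x3 x4 s1 s2 s3 s4 q1 q2) =
    (v x1 :: map v s1 ++ v x2 :: map v s2 ++ v x3 :: map v s3 ++
      v x4 :: map v s4) ++ map v q1 ++ map v q2.
  by rewrite /frame /= !map_cat /= !map_cat /= !map_cat.
have [|F [sF VF EF]] := @K4_cycle_crossing_paths T (v x1) (v x2) (v x3) (v x4)
  (map v s1) (map v s2) (map v s3) (map v s4) (map v q1) (map v q2).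
  by rewrite -frame_map map_inj_in_uniq.
have memF E : (E \in edges F) =
    (E \in map span (frame_steps x1 x2 x3 x4 s1 s2 s3 s4 q1 q2)).
  have -> : edges F = trail (v x1)
      (map v (s1 ++ x2 :: s2 ++ x3 :: s3 ++ x4 :: rcons s4 x1)) :|:
      trail (v x1) (map v (rcons q1 x3)) :|: trail (v x2) (map v (rcons q2 x4)).
    by rewrite EF !(map_cat, map_rcons) /= !(map_cat, map_rcons) /=
      !(map_cat, map_rcons) /= map_rcons.
  by rewrite !trail_map !inE /frame_steps !map_cat !mem_cat orbA.
exists F; split=> //.
- move=> w; rewrite VF inE -frame_map => /mapP[i /(allP mF) im ->].
  exact: mem_nth.
- move=> f /(allP tF) /orP[] fs; rewrite memF; apply/mapP.
    by exists f.
  by exists (swap f); rewrite ?span_swap.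
- move=> E; rewrite memF => /mapP[u us ->].
  have [um1 um2] : u.1 < size c /\ u.2 < size c.
    have inF w : w \in frame x1 x2 x3 x4 s1 s2 s3 s4 q1 q2 -> w < size c by move/(allP mF).
    move: us; rewrite /frame_steps !mem_cat => /or3P[] /mem_steps/andP[h1 h2];
      split; apply: inF; [move: h1 | move: h2 | move: h1 | move: h2 | move: h1 | move: h2];
      rewrite /frame !(in_cons, mem_cat, mem_rcons, inE) -?orbA;
      by repeat (case/orP => [->|]); rewrite ?orbT // => ->; rewrite ?orbT.
  case/or4P: (allP aF _ us) => [/eqP uu|/eqP uu|uM|/or3P[uM|/eqP uu|/eqP uu]].
  + by constructor 1; exists u.1 => //; rewrite /rim /span /= -uu modn_small.
  (* The closing step from the last position to [0] is the last edge of the cycle. *)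
  + constructor 1; exists (size c).-1; first by case: (size c) um1.
    by rewrite uu /rim prednK ?modnn //; case: (size c) um1.
  + by constructor 3; exists u.
  + by constructor 3; exists (swap u); rewrite ?span_swap.
  + by constructor 2; rewrite uu.
  + by constructor 2; rewrite -uu span_swap.
Qed.

End Lift.

(** * Rotations of a longest path *)

Lemma adjC (T : finType) (G : graph T) x y : adj G x y = adj G y x.
Proof. by rewrite /adj setUC. Qed.

Lemma adj_neq (T : finType) (G : graph T) x y : adj G x y -> x != y.
Proof. by move=> /graph_edge[+ _]; rewrite cards2; case: (x != y). Qed.

Lemma adj_vertices (T : finType) (G : graph T) x y :
  adj G x y -> (x \in vertices G) && (y \in vertices G).
Proof.
by move=> /graph_edge[_ /subsetP sub]; rewrite !sub // !inE eqxx ?orbT.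
Qed.

Lemma edge_adj (T : finType) (G : graph T) e x :
  e \in edges G -> x \in e -> exists2 y, adj G x y & e = [set x; y].
Proof.
move=> Ge xe; have [/eqP/cards2P[a [b [_ def_e]]] _] := graph_edge Ge.
move: xe; rewrite def_e !inE => /orP[] /eqP->.
  by exists b; rewrite // /adj -def_e.
by exists a; rewrite 1?setUC // /adj setUC -def_e.
Qed.

(** Induction along reachability, for properties preserved by rotations. *)
Lemma connect_elim (V : finType) (e : rel V) x (P : V -> Prop) :
  P x -> (forall y z, connect e x y -> P y -> e y z -> P z) ->
  forall y, connect e x y -> P y.
Proof.
move=> Px step y /connectP[p ep ->].
elim/last_ind: p ep => [|p z IHp] //; rewrite rcons_path last_rcons => /andP[ep ez].
by apply: step (IHp ep) ez; apply/connectP; exists p.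
Qed.

Section Links.

Variable T : eqType.
Implicit Types (x y u : T) (s : seq T).

Definition links s := if s is x :: p then steps x p else [::].

Definition touch s x y := ((x, y) \in links s) || ((y, x) \in links s).

Lemma links_cat s1 u s2 :
  links (s1 ++ u :: s2) = links (rcons s1 u) ++ steps u s2.
Proof.
case: s1 => [|x s1] //=.
by rewrite -cats1 !steps_cat /= -catA.
Qed.

Lemma links_rev s x y : ((x, y) \in links (rev s)) = ((y, x) \in links s).
Proof.
elim: s => [|z s IHs] //; rewrite rev_cons.
case: s IHs => [|w s] IHs //.
have -> : rcons (rev (w :: s)) z = rev s ++ w :: [:: z].
  by rewrite rev_cons -!cats1 -catA.
rewrite links_cat -rev_cons mem_cat IHs /= !inE orbC.
by rewrite -!pair_eqE /= andbC.
Qed.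

(** Reversing the tail keeps its inner links up to direction and replaces only the link from [u] to
    [z] by one from [u] to the old last vertex. As [touch] ignores direction, every other vertex
    keeps its path neighbours. *)
Lemma touch_rotation s1 u z s2 x y :
  x \notin [:: u; z; last z s2] ->
  touch (s1 ++ u :: rev (z :: s2)) x y = touch (s1 ++ u :: z :: s2) x y.
Proof.
rewrite !inE !negb_or => /and3P[xu xz xl].
have [s' def_s] : exists s', rev (z :: s2) = last z s2 :: s'.
  by exists (rev (belast z s2)); rewrite lastI rev_rcons.
have stepsE a b s : ((a, b) \in steps u s) =
    if s is w :: s' then (a == u) && (b == w) || ((a, b) \in links s) else false.
  by case: s => [|w s] //=; rewrite inE -pair_eqE.
have revE a b : ((a, b) \in steps u (rev (z :: s2))) =
    (a == u) && (b == last z s2) || ((b, a) \in links (z :: s2)).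
  by rewrite -links_rev stepsE def_s.
have zE a b : ((a, b) \in steps u (z :: s2)) =
    (a == u) && (b == z) || ((a, b) \in links (z :: s2)) by rewrite stepsE.
rewrite /touch !links_cat !mem_cat !revE !zE.
rewrite (negbTE xu) (negbTE xz) (negbTE xl) !andbF !orFb.
by case: ((y, x) \in links (z :: s2)); case: ((x, y) \in links (z :: s2));
  rewrite ?orbT ?orbF.
Qed.

Lemma links_split s x y :
  (x, y) \in links s -> exists s1 s2, s = s1 ++ x :: y :: s2.
Proof.
case: s => [|a s] //=; elim: s a => [|b s IHs] a //=.
rewrite inE => /predU1P[[-> ->]|/IHs[s1 [s2 ->]]]; first by exists [::], s.
by exists (a :: s1), s2.
Qed.

Lemma links_nth x0 s x y :
  uniq s -> (x, y) \in links s ->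
  y = nth x0 s (index x s).+1 /\ x = nth x0 s (index y s).-1.
Proof.
move=> us /links_split[s1 [s2 def_s]].
have def_s' : s = rcons s1 x ++ y :: s2 by rewrite cat_rcons.
have ix : index x s = size s1.
  move: us; rewrite def_s cat_uniq /= negb_or => /and3P[_ /andP[xs _] _].
  by rewrite index_cat (negbTE xs) /= eqxx addn0.
have iy : index y s = (size s1).+1.
  move: us; rewrite def_s' cat_uniq /= negb_or => /and3P[_ /andP[ys _] _].
  by rewrite index_cat (negbTE ys) /= eqxx addn0 size_rcons.
rewrite ix iy /=; split; last by rewrite def_s nth_cat ltnn subnn.
by rewrite def_s' nth_cat size_rcons ltnn subnn.
Qed.

End Links.

Lemma sorted_cat_cons (T : Type) (e : rel T) s1 u s2 :
  sorted e (s1 ++ u :: s2) = sorted e (rcons s1 u) && path e u s2.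
Proof. by case: s1 => [|x s1] //=; rewrite cat_path rcons_path /= andbA. Qed.

Lemma path_rev (T : Type) (e : rel T) u z s :
  symmetric e -> e u (last z s) -> path e z s -> path e u (rev (z :: s)).
Proof.
move=> sym eul ps; rewrite lastI rev_rcons /= eul rev_path.
by rewrite (eq_path (e' := e)) // => x y; rewrite sym.
Qed.

Definition nbhd (T : finType) (G : graph T) (S : {set T}) : {set T} :=
  [set u | [exists s in S, adj G s u]].

Definition incident (T : finType) (G : graph T) (S : {set T}) : {set {set T}} :=
  [set e in edges G | ~~ [disjoint e & S]].

Lemma incidentP (T : finType) (G : graph T) (S : {set T}) e :
  reflect (exists s u, [/\ s \in S, adj G s u & e = [set s; u]])
          (e \in incident G S).
Proof.
apply: (iffP idP) => [|[s [u [sS su ->]]]].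
  rewrite inE => /andP[Ge /pred0Pn[s /andP[/= se sS]]].
  by have [u su ->] := edge_adj Ge se; exists s, u.
rewrite in_set; apply/andP; split=> //; apply/pred0Pn; exists s.
by rewrite /= !inE eqxx.
Qed.

(* Rotations of a longest path fix its start.  A vertex outside [S] with no
   neighbour on the path in [S] keeps both its path neighbours under every
   rotation, so it cannot be adjacent to an end: rotating at it would make one
   of these neighbours an end.  Rotations also fix the path up to the first
   vertex [v] of [N(S)], and some rotated path ends at a neighbour of [v]. *)
Lemma rotation_cycle (T : finType) (G : graph T) :
  vertices G != set0 ->
  exists S : {set T},
    [/\ S != set0, S :|: nbhd G S \subset vertices G,
        #|S :|: nbhd G S| <= 3 * #|S|
      & (exists c, [/\ uniq c, cycle (adj G) c, 2 < size c
                     & {subset S :|: nbhd G S <= c}]) \/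
        #|incident G S| <= 1].
Proof.
case/set0Pn => x0 Gx0.
pose gpath s := [&& uniq s, sorted (adj G) s & all [in vertices G] s].
pose P k := [exists t : k.+1.-tuple T, gpath t].
have exP : exists k, P k.
  by exists 0; apply/existsP; exists [tuple x0]; rewrite /gpath /= Gx0.
have ubP k : P k -> k <= #|T|.
  case/existsP => t /andP[/card_uniqP ut _].
  by apply: ltnW; rewrite -(size_tuple t) -ut max_card.
have [k /existsP[t0 gt0] maxk] := ex_maxnP exP ubP.
pose rot (t t' : k.+1.-tuple T) := [exists i : 'I_k.+1,
  adj G (tnth t i) (last x0 t) && (tval t' == take i.+1 t ++ rev (drop i.+1 t))].
have rotP t t' : rot t t' -> exists s1 u s2,
    [/\ tval t = s1 ++ u :: s2, tval t' = s1 ++ u :: rev s2, size s1 < k.+1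
      & adj G u (last x0 t)].
  case/existsP => i /andP[ai /eqP def_t'].
  have it : i < size t by rewrite size_tuple.
  exists (take i t), (tnth t i), (drop i.+1 t).
  have tk : take i.+1 t = rcons (take i t) (tnth t i).
    by rewrite (take_nth x0) // (tnth_nth x0).
  split=> //; first by rewrite -cat_rcons -tk cat_take_drop.
    by rewrite -cat_rcons -tk.
  by rewrite size_take_min (leq_ltn_trans (geq_minl _ _)).
have rotI (t : k.+1.-tuple T) s1 u s2 : tval t = s1 ++ u :: s2 -> adj G u (last x0 t) ->
    exists2 t' : k.+1.-tuple T, rot t t' & tval t' = s1 ++ u :: rev s2.
  move=> def_t au.
  have sz : size (s1 ++ u :: rev s2) == k.+1.
    by rewrite size_cat /= size_rev -(size_tuple t) def_t size_cat.
  exists (Tuple sz) => //; apply/existsP.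
  have lt_i : size s1 < k.+1 by rewrite -(eqP sz) size_cat /= -addSnnS leq_addr.
  exists (Ordinal lt_i); rewrite (tnth_nth x0) /= {1 3 4}def_t.
  rewrite nth_cat ltnn subnn /= au /= -!cat_rcons.
  by rewrite -(size_rcons s1 u) take_size_cat // drop_size_cat.
have reach_gpath t : connect rot t0 t -> gpath t /\ perm_eq t t0.
  move: t; apply: connect_elim => // t t' _ [gt pt] /rotP[s1 [u [s2 [def_t def_t' _ au]]]].
  have pt' : perm_eq t' t.
    by rewrite def_t def_t' perm_cat2l perm_cons perm_rev.
  split; last exact: perm_trans pt' pt.
  case/and3P: gt => ut st vt; apply/and3P; split.
  - by rewrite (perm_uniq pt').
  - rewrite def_t' sorted_cat_cons; move: st; rewrite def_t sorted_cat_cons.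
    case/andP => -> /=; case: s2 def_t def_t' => [|z s2] // def_t _ /= /andP[_ pz].
    by apply: path_rev => //; [exact: adjC | move: au; rewrite def_t last_cat].
  - by rewrite (perm_all _ pt').
pose S := [set w | [exists t, connect rot t0 t && (last x0 t == w)]].
have lastS (t : k.+1.-tuple T) : connect rot t0 t -> last x0 t \in S.
  by move=> rt; rewrite inE; apply/existsP; exists t; rewrite rt eqxx.
have SP w : w \in S -> exists2 t : k.+1.-tuple T, connect rot t0 t & last x0 t = w.
  by rewrite inE => /existsP[t /andP[rt /eqP]]; exists t.
have NP u : u \in nbhd G S ->
    exists2 t : k.+1.-tuple T, connect rot t0 t & adj G (last x0 t) u.
  by rewrite inE => /existsP[w /andP[/SP[t rt <-] au]]; exists t.
(* A neighbour of an end off the path would extend it beyond maximal length; rotated paths all have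
   the vertices of [t0]. *)
have maximal (t : k.+1.-tuple T) u :
    connect rot t0 t -> adj G (last x0 t) u -> u \in t0.
  move=> rt au; have [/and3P[ut st vt] pt] := reach_gpath t rt.
  rewrite -(perm_mem pt); apply: contraT => ut'.
  have : P k.+1.
    apply/existsP; exists [tuple of rcons t u]; apply/and3P; split.
    - by rewrite rcons_uniq ut' ut.
    - rewrite /=; case: (tval t) (size_tuple t) st au => [|x p] //= _.
      by rewrite rcons_path => -> ->.
    - by rewrite all_rcons vt andbT; case/andP: (adj_vertices au).
  by move/maxk; rewrite ltnn.
have ut0 : uniq t0 by case/and3P: gt0.
have last_rot (t t' : k.+1.-tuple T) s1 u z s2 : tval t = s1 ++ u :: z :: s2 ->
    tval t' = s1 ++ u :: rev (z :: s2) -> last x0 t' = z.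
  by move=> _ ->; rewrite last_cat /= rev_cons last_rcons.
have clean u : u \notin S -> (forall w, w \in S -> ~~ touch t0 u w) ->
    forall t : k.+1.-tuple T, connect rot t0 t -> forall y, touch t u y = touch t0 u y.
  move=> uS uclean; apply: connect_elim => // t t' rt IHt rtt' y.
  have rt' : connect rot t0 t' := connect_trans rt (connect1 rtt').
  have [s1 [u' [[|z s2] [def_t def_t' _ _]]]] := rotP _ _ rtt'.
    by rewrite def_t' -IHt def_t.
  have zS : z \in S by rewrite -(last_rot _ _ _ _ _ _ def_t def_t') lastS.
  have lS : last z s2 \in S by have := lastS t rt; rewrite def_t last_cat.
  rewrite def_t' touch_rotation -?def_t //.
  rewrite !inE !negb_or; apply/and3P; split.
  - apply/negP => /eqP def_u; have := uclean z zS; rewrite -IHt def_t def_u.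
    by rewrite /touch links_cat mem_cat /= inE eqxx orbT.
  - by apply: contraNneq uS => ->.
  - by apply: contraNneq uS => ->.
have touchS u : u \in nbhd G S -> u \notin S -> exists2 w, w \in S & touch t0 u w.
  move=> uN uS; apply/exists_inP; apply: contraT => /exists_inPn uclean.
  have [t rt au] := NP u uN.
  have ut : u \in t.
    by have [_ /perm_mem->] := reach_gpath t rt; apply: maximal rt au.
  have [s1 [s2 def_t]] : exists s1 s2, tval t = s1 ++ u :: s2.
    by case/splitPr: ut => s1 s2; exists s1, s2.
  case: s2 def_t => [|z s2] def_t.
    by case/negP: uS; have := lastS t rt; rewrite def_t last_cat.
  have [|t' rtt' def_t'] := rotI t _ _ _ def_t; first by rewrite adjC.
  have zS : z \in S.
    rewrite -(last_rot _ _ _ _ _ _ def_t def_t').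
    exact: lastS (connect_trans rt (connect1 rtt')).
  have /negP[] := uclean z zS; rewrite -(clean u uS uclean t rt).
  by rewrite /touch def_t links_cat mem_cat /= inE eqxx orbT.
have cardS : #|S :|: nbhd G S| <= 3 * #|S|.
  (* [f1] and [f2] give the successor and the predecessor on [t0]. Each vertex of $N(S) \setminus S$
     is such a neighbour of a vertex of [S], whence the factor 3. *)
  pose f1 w := nth x0 t0 (index w t0).+1; pose f2 w := nth x0 t0 (index w t0).-1.
  have sub : S :|: nbhd G S \subset S :|: (f1 @: S :|: f2 @: S).
    apply/subsetP => u; rewrite !in_setU; case: (boolP (u \in S)) => //= uS uN.
    have [w wS /orP[uw|wu]] := touchS u uN uS; apply/orP; [right|left].
      by apply/imsetP; exists w => //; have [] := links_nth x0 ut0 uw.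
    by apply/imsetP; exists w => //; have [] := links_nth x0 ut0 wu.
  apply: leq_trans (subset_leq_card sub) _.
  rewrite !mulSn mul0n addn0.
  apply: leq_trans (leq_card_setU _ _) _; rewrite leq_add2l.
  apply: leq_trans (leq_card_setU _ _) _.
  by apply: leq_add; apply: leq_imset_card.
exists S; split=> //.
- by apply/set0Pn; exists (last x0 t0); apply: lastS.
- apply/subsetP => u; rewrite in_setU => /orP[/SP[t rt <-]|/NP[t rt /adj_vertices/andP[]//]].
  have [/and3P[_ _ /allP vt] _] := reach_gpath t rt; apply: vt.
  by case: (tval t) (size_tuple t) => [|x p] //= _; apply: mem_last.
case: (set_0Vmem (nbhd G S)) => [N0|[u1 u1N]].
  right; rewrite (_ : incident G S = set0) ?cards0 //.
  apply/eqP; rewrite -subset0; apply/subsetP => e /incidentP[s [u [sS su _]]].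
  suff : u \in nbhd G S by rewrite N0 inE.
  by rewrite inE; apply/existsP; exists s; rewrite sS.
pose j := find [in nbhd G S] t0.
have hasN : has [in nbhd G S] t0.
  apply/hasP; exists u1 => //; have [t rt au] := NP _ u1N; exact: maximal rt au.
have ltj : j < k.+1 by rewrite -(size_tuple t0) -has_find.
pose v := nth x0 t0 j.
have vN : v \in nbhd G S by exact: nth_find.
have prefix (t : k.+1.-tuple T) : connect rot t0 t -> take j.+1 t = take j.+1 t0.
  move: t; apply: connect_elim => // t t' rt IHt rtt'.
  have [s1 [u [s2 [def_t def_t' sz1 au]]]] := rotP _ _ rtt'.
  (* The pivot [u] is adjacent to the end of [t], so it lies in $N(S)$ and cannot precede the first
     vertex of $N(S)$ on the path. *)
  suff js1 : j <= size s1.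
    by rewrite -IHt def_t def_t' -!cat_rcons !takel_cat // size_rcons.
  rewrite leqNgt; apply/negP => s1j; have := before_find x0 s1j.
  have -> : nth x0 t0 (size s1) = u.
    rewrite -(nth_take x0 (leq_trans s1j (leqnSn j))) -IHt nth_take ?ltnS 1?ltnW //.
    by rewrite def_t nth_cat ltnn subnn.
  move/negP; apply; rewrite inE; apply/existsP; exists (last x0 t).
  by rewrite lastS //= adjC.
have [t rt av] := NP v vN.
have [/and3P[ut st _] pt] := reach_gpath t rt.
pose s2 := drop j.+1 t.
have def_t : tval t = take j t0 ++ v :: s2.
  have -> : take j t0 = take j t.
    by rewrite -(take_takel t0 (leqnSn j)) -(prefix t) // take_takel.
  have -> : v = nth x0 t j.
    by rewrite /v -(nth_take x0 (ltnSn j)) -(prefix t) // nth_take.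
  by rewrite -cat_rcons -take_nth ?size_tuple // cat_take_drop.
have Nsub u : u \in nbhd G S -> u \in v :: s2.
  move=> uN; have [t' rt' au] := NP u uN.
  have : u \in tval t by rewrite (perm_mem pt); apply: maximal rt' au.
  rewrite def_t mem_cat => /orP[uj|//].
  have := before_find x0 (index_ltn uj).
  by rewrite nth_index ?(mem_take uj) // => /negP[].
have sz2 : 0 < size s2.
  rewrite lt0n size_eq0; apply/eqP => s20; move: av; rewrite def_t s20 last_cat /=.
  by move/adj_neq; rewrite eqxx.
(* A vertex of [S] ends some rotated path, at index [k]. The prefix of length [j.+1] shared by all
   rotated paths stops before that index, because [s2] is nonempty. *)
have Ssub u : u \in S -> u \in s2.
  move=> /SP[t' rt' def_u]; have [/and3P[ut' _ _] pt'] := reach_gpath t' rt'.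
  have in_t : u \in take j.+1 t ++ s2.
    rewrite cat_take_drop (perm_mem pt) -(perm_mem pt') -def_u.
    by case: (tval t') (size_tuple t') => [|x p] //= _; apply: mem_last.
  move: in_t; rewrite mem_cat => /orP[|//]; rewrite prefix // -(prefix t') //.
  move/index_ltn; rewrite -def_u -nth_last size_tuple /= index_uniq ?size_tuple //.
  move=> kj; move: sz2; rewrite size_drop size_tuple subn_gt0 ltnS.
  by rewrite ltnNge -ltnS kj.
(* If [s2] has one vertex, closing the path gives no cycle; but then [S] contains only that vertex,
   and its only possible edge goes to [v]. *)
case def2: s2 sz2 => [//|z [|z' s]] _.
  right; rewrite -(cards1 [set z; v]); apply: subset_leq_card.
  apply/subsetP => e /incidentP[s [u [sS su ->]]]; rewrite inE.
  have : u \in nbhd G S by rewrite inE; apply/existsP; exists s; rewrite sS.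
  move/Nsub; move/Ssub: sS; rewrite def2 !inE => /eqP def_s.
  rewrite def_s in su *; case/orP=> /eqP def_u; first by rewrite def_u.
  by have := adj_neq su; rewrite def_u eqxx.
left; exists (v :: s2); split.
- by move: ut; rewrite def_t cat_uniq => /and3P[].
- rewrite /= rcons_path; apply/andP; split.
    by move: st; rewrite def_t sorted_cat_cons => /andP[].
  by move: av; rewrite def_t last_cat.
- by rewrite def2.
- by move=> u; rewrite in_setU => /orP[/Ssub|/Nsub//]; rewrite in_cons orbC => ->.
Qed.

(** * Chords of a cycle through marked vertices *)

Definition vals (h : nat) (p : 'I_h * 'I_h) : chord := (val p.1, val p.2).

Lemma crossesC e g : crosses e g = crosses g e.
Proof. by rewrite /crosses orbC. Qed.

(* Each chord [p] of a noncrossing family sees a point strictly below it which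
   no chord of the family that does not contain [p] covers. *)
Lemma noncrossing_bound (h : nat) (X : {set 'I_h * 'I_h}) :
  (forall p, p \in X -> p.1.+1 < p.2) ->
  (forall p q, p \in X -> q \in X -> ~~ crosses (vals p) (vals q)) ->
  #|X| <= h.
Proof.
move=> longX ncX.
pose sees (p : 'I_h * 'I_h) (x : 'I_h) := (p.1 < x < p.2) &&
  [forall q in X, (q.1 < x < q.2) ==> (q.1 <= p.1) && (p.2 <= q.2)].
have exposed p : p \in X -> exists x, sees p x.
  move=> pX; have p12 := longX p pX.
  (* The point seen is the right end of the longest chord of [X] from [p.1] that is shorter than
     [p], or [p.1.+1] if there is none. A chord over this point that does not contain [p] would
     cross [p] or that shorter chord, or contradict its choice. *)
  pose P x := (p.1 < x < p.2) &&
    ((x == p.1.+1) || [exists y : 'I_h, (val y == x) && ((p.1, y) \in X)]).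
  have exP : exists x, P x by exists p.1.+1; rewrite /P ltnSn p12 eqxx.
  have ubP x : P x -> x <= p.2 by case/andP => /andP[_ /ltnW].
  have [x /andP[px hx] maxx] := ex_maxnP exP ubP.
  have ltxh : x < h by case/andP: px => _ xp; apply: ltn_trans xp (ltn_ord _).
  exists (Ordinal ltxh); rewrite /sees /= px; apply/forall_inP => q qX.
  apply/implyP => qx.
  have q1 : q.1 <= p.1.
    rewrite leqNgt; apply/negP => pq.
    case/orP: hx => [/eqP hx|/existsP[y /andP[/eqP yx yX]]].
      by move: qx; rewrite hx ltnS leqNgt pq.
    have := ncX _ _ yX qX; rewrite /crosses /= yx.
    by case/andP: qx => -> ->; rewrite pq.
  rewrite q1 leqNgt; apply/negP => q2.
  move: q1; rewrite leq_eqVlt => /orP[/eqP q1|q1].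
    have /maxx : P q.2.
      rewrite /P q2 andbT; apply/andP; split.
        by case/andP: qx px => _ qx /andP[px _]; apply: ltn_trans qx.
      apply/orP; right; apply/existsP; exists q.2; rewrite eqxx /=.
      by rewrite -(val_inj q1) -surjective_pairing.
    by rewrite leqNgt; case/andP: qx => _ ->.
  have := ncX _ _ qX pX; rewrite /crosses /= q1 q2.
  by case/andP: qx px => _ qx /andP[px _]; rewrite (ltn_trans px qx).
pose f (p : 'I_h * 'I_h) := odflt p.1 [pick x | sees p x].
have seef p : p \in X -> sees p (f p).
  move=> /exposed[x sx]; rewrite /f; case: pickP => [//|] /(_ x).
  by rewrite sx.
rewrite -[leqRHS]card_ord -(@card_in_imset _ _ f X); first exact: max_card.
(* Two chords that see the same point both cover it, so each contains the other. *)
move=> p q pX qX eq_f.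
have /andP[fp /forall_inP sp] := seef p pX.
have /andP[fq /forall_inP sq] := seef q qX.
rewrite eq_f in fp sp.
have /andP[q1 q2] := implyP (sp q qX) fq.
have /andP[p1 p2] := implyP (sq p pX) fp.
rewrite [p]surjective_pairing [q]surjective_pairing.
by congr (_, _); apply/val_inj/eqP; rewrite eqn_leq ?p1 ?p2 ?q1 ?q2.
Qed.

Definition member (T : finType) (G F : graph T) :=
  subgraph F G /\ (single_edge F \/ subdivision (complete_graph 4) F).

Lemma difference_chain a b a' b' :
  a < b -> a' < b' -> (a != a') || (b != b') -> b - a = b' - a' ->
  (a < a') && (b < b') || (a' < a) && (b' < b).
Proof. lia. Qed.

(** Equality gives [b - b' = 2 * (a - a')] as integers, so both coordinates move in the same
    direction. The summand [h] prevents truncation, as [2 * a < h + b]. *)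
Lemma skew_difference_chain h a b a' b' :
  a < b < h -> a' < b' < h -> (a != a') || (b != b') ->
  h + b - 2 * a = h + b' - 2 * a' ->
  (a < a') && (b < b') || (a' < a) && (b' < b).
Proof. lia. Qed.

Lemma differences_inj h a b a' b' :
  a < b < h -> a' < b' < h -> b - a = b' - a' ->
  h + b - 2 * a = h + b' - 2 * a' -> (a == a') && (b == b').
Proof. lia. Qed.

Lemma pair_ord_neq h (p q : 'I_h * 'I_h) :
  (p != q) = (val p.1 != val q.1) || (val p.2 != val q.2).
Proof. by rewrite -pair_eqE negb_and. Qed.

Section MarkedCycle.

Variables (T : finType) (x0 : T) (G : graph T) (c : seq T) (W : {set T}).
Variable (E : {set {set T}}).
Hypotheses (uc : uniq c) (cc : cycle (adj G) c) (szc : 2 < size c).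
Hypotheses (Wc : {subset W <= c}) (EG : E \subset edges G).
Hypothesis (EW : forall e, e \in E -> e \subset W).

Let marked := [seq v <- c | v \in W].
Let h := size marked.
Let pos i := index (nth x0 marked i) c.
Let emb (p : 'I_h * 'I_h) : chord := (pos p.1, pos p.2).
Let edge (p : 'I_h * 'I_h) := span x0 c (emb p).
(** Ends are recorded by rank among the marked vertices, so differences are bounded by [#|W|] and
    not by the length of [c]. Cyclically consecutive ranks are left out because their edge may lie
    on [c]. *)
Let chords := [set p : 'I_h * 'I_h |
  [&& p.1.+1 < p.2, ~~ ((val p.1 == 0) && (val p.2 == h.-1)) & edge p \in E]].

Let uniq_marked : uniq marked. Proof. exact: filter_uniq. Qed.

Let size_marked : h = #|W|.
Proof.
rewrite /h -(card_uniqP uniq_marked); apply: eq_card => v.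
by rewrite mem_filter; case: (boolP (v \in W)) => //= /Wc.
Qed.

Let nth_marked i : i < h -> nth x0 marked i \in c.
Proof. by move=> ih; have := mem_nth x0 ih; rewrite mem_filter => /andP[]. Qed.

Let pos_lt i : i < h -> pos i < size c.
Proof. by move=> ih; rewrite index_mem nth_marked. Qed.

Let nth_pos i : i < h -> nth x0 c (pos i) = nth x0 marked i.
Proof. by move=> ih; rewrite nth_index ?nth_marked. Qed.

Let pos_mono i j : i < j -> j < h -> pos i < pos j.
Proof.
move=> ij jh; have : pairwise (fun u v => index u c < index v c) marked.
  apply: subseq_pairwise (filter_subseq _ _) _; apply/(pairwiseP x0) => a b ac bc ab.
  by rewrite !index_uniq.
move/(pairwiseP x0); apply => //; exact: ltn_trans jh.
Qed.

Let pos_monoE i j : i < h -> j < h -> (pos i < pos j) = (i < j).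
Proof.
move=> ih jh; case: (ltngtP i j) => [ij|ji|->]; last by rewrite ltnn.
  exact: pos_mono.
by apply/negbTE; rewrite -leqNgt ltnW // pos_mono.
Qed.

Let emb_lt2 p q : lt2 (emb p) (emb q) = lt2 (vals p) (vals q).
Proof. by rewrite /lt2 /= !pos_monoE. Qed.

Let emb_crosses p q : crosses (emb p) (emb q) = crosses (vals p) (vals q).
Proof. by rewrite /crosses /= !pos_monoE. Qed.

Let emb_inj : injective emb.
Proof.
have pos_inj : {in gtn h &, injective pos}.
  move=> i j ih jh eq_ij.
  by case: (ltngtP i j) => // [ij|ji]; [have := pos_mono ij jh | have := pos_mono ji ih];
    rewrite eq_ij ltnn.
by move=> [a b] [a' b'] [] /pos_inj ea /pos_inj eb; congr (_, _); apply: val_inj;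
  [apply: ea | apply: eb]; apply: ltn_ord.
Qed.

Let chord_lt p : p \in chords -> p.1 < p.2.
Proof. by rewrite inE => /and3P[/ltnW]. Qed.

Let span_inj a b a' b' :
  a < b < size c -> a' < b' < size c ->
  span x0 c (a, b) = span x0 c (a', b') -> (a, b) = (a', b').
Proof.
move=> /andP[ab bc] /andP[ab' bc'] eq_s.
have ac := ltn_trans ab bc; have ac' := ltn_trans ab' bc'.
have ina i : i < size c -> (nth x0 c i \in span x0 c (a, b)) = (i == a) || (i == b).
  by move=> ic; rewrite !inE !nth_uniq.
have := ina a' ac'; have := ina b' bc'; rewrite eq_s !inE !eqxx orbT.
move=> /esym hb /esym ha; congr (_, _); case/orP: ha ab' => /eqP ->;
  case/orP: hb => /eqP ->; rewrite ?ltnn // => ba; by rewrite ltnNge ltnW in ab.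
Qed.

Let edge_inj p q : p \in chords -> q \in chords -> edge p = edge q -> p = q.
Proof.
move=> /chord_lt pc /chord_lt qc /span_inj eq_e; apply: emb_inj.
by apply: eq_e; rewrite pos_mono ?pos_lt.
Qed.

(** Each of the two arcs of [c] between the ends of a chord has a marked vertex in its interior, so
    the ends are not consecutive on [c]. *)
Let rim_chord p i : p \in chords -> i < size c -> edge p <> rim x0 c i.
Proof.
rewrite inE => /and3P[p12 p0h _] ic; rewrite /edge /rim.
have ltp : pos p.1 < pos p.2 by apply: pos_mono => //; apply: ltnW.
case: (ltnP i.+1 (size c)) => [ic'|ci].
  rewrite modn_small // => eq_e.
  have [e1 e2] : (pos p.1, pos p.2) = (i, i.+1).
    by apply: span_inj eq_e; rewrite ?ltp ?ltnSn ?pos_lt.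
  have h1 : p.1.+1 < h := ltn_trans p12 (ltn_ord _).
  have := pos_mono (ltnSn p.1) h1; have := pos_mono p12 (ltn_ord _).
  by rewrite e2 ltnS -e1 leqNgt => /negbTE->.
have def_i : i = (size c).-1 by move: ic ci; case: (size c) => // n; rewrite ltnS => *; apply/eqP; rewrite eqn_leq; apply/andP.
have sc : i.+1 = size c by rewrite def_i prednK // (leq_ltn_trans _ szc).
rewrite sc modnn -[RHS]span_swap => eq_e.
have [e1 e2] : (pos p.1, pos p.2) = (0, i).
  apply: span_inj eq_e; rewrite ?ltp ?pos_lt // ic andbT -ltnS sc.
  exact: ltnW.
move/negP: p0h; apply; apply/andP; split.
  rewrite -leqn0 leqNgt; apply/negP => p1.
  by have := pos_mono p1 (ltn_ord _); rewrite e1.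
have hp : 0 < h by apply: leq_ltn_trans (ltn_ord p.2).
rewrite eqn_leq -ltnS prednK // ltn_ord leqNgt; apply/negP => p2.
have h1 : h.-1 < h by rewrite prednK.
by have := pos_mono p2 h1; rewrite e2 def_i ltnNge -ltnS prednK ?pos_lt // ltnW // ltnW.
Qed.

Let rim_edge i : i < size c -> rim x0 c i \in edges G.
Proof.
move=> ic; rewrite /rim /span /=.
move: cc; rewrite /cycle; case def_c: c ic szc => [//|x p] ic _.
move=> /(pathP x0)/(_ i); rewrite size_rcons => /(_ ic).
rewrite /adj -rcons_cons nth_rcons /= ic nth_rcons.
move: ic; rewrite ltnS leq_eqVlt => /predU1P[->|ip].
  by rewrite ltnn eqxx modnn.
by rewrite ip modn_small // ltnS.
Qed.

Let within (Q : {set 'I_h * 'I_h}) (F : graph T) := forall e, e \in edges F ->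
  [\/ exists2 i, i < size c & e = rim x0 c i
    | exists2 p, p \in Q & e = edge p].

Let spans_crossings (frameset : {set 'I_h * 'I_h}) :=
  frameset \subset chords /\ forall p, p \in chords :\: frameset ->
    exists2 g, g \in frameset & crosses (vals p) (vals g).

(** Sorted by left ends, [Q] is a chain and splits into three zigzags. Each nonempty one yields a
    subdivision, with a chord of [frameset] that crosses its first chord as the extra chord. *)
Let chain_family (frameset Q : {set 'I_h * 'I_h}) :
  spans_crossings frameset ->
  Q \subset chords :\: frameset ->
  (forall p q, p \in Q -> q \in Q -> p != q ->
     lt2 (vals p) (vals q) || lt2 (vals q) (vals p)) ->
  exists FF : {set graph T},
    [/\ #|FF| <= 3,
        forall F, F \in FF -> member G F /\ within (frameset :|: Q) F
      & forall p, p \in Q -> exists2 F, F \in FF & edge p \in edges F].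
Proof.
move=> [frame_chords frame_crosses] /subsetP sQ chainQ.
have chQ p : p \in Q -> p \in chords by move/sQ; rewrite in_setD => /andP[].
pose r : rel chord := fun e f => e.1 <= f.1.
pose M := sort r (map emb (enum Q)).
have memM e : reflect (exists2 p, p \in Q & e = emb p) (e \in M).
  rewrite mem_sort; apply: (iffP mapP) => -[p pQ ->]; exists p => //;
  by rewrite mem_enum in pQ *.
have uM : uniq M by rewrite sort_uniq map_inj_uniq ?enum_uniq.
have rM : pairwise r M.
  rewrite -sorted_pairwise; last by move=> ? ? ?; apply: leq_trans.
  by apply: sort_sorted => ? ?; apply: leq_total.
have pM : pairwise lt2 M.
  apply/(pairwiseP (0, 0)) => i j iM jM ij.
  have rij := (pairwiseP (0, 0) rM) i j iM jM ij.
  have [p pQ ep] := memM _ (mem_nth (0, 0) iM).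
  have [q qQ eq] := memM _ (mem_nth (0, 0) jM).
  have npq : p != q.
    apply/eqP => pq; have /eqP : nth (0, 0) M i = nth (0, 0) M j.
      by rewrite ep eq pq.
    by rewrite nth_uniq // ltn_eqF.
  rewrite ep eq in rij *; have := chainQ p q pQ qQ npq.
  rewrite -!emb_lt2 => /orP[//|/andP[qp _]].
  by move: rij; rewrite /r leqNgt qp.
have bM : all (fun e => e.1 < e.2) M.
  by apply/allP => e /memM[p /chQ/chord_lt pc ->]; rewrite pos_mono.
have single L : zigzag 0 L -> {subset L <= M} -> exists FF : {set graph T},
    [/\ #|FF| <= 1,
        forall F, F \in FF -> member G F /\ within (frameset :|: Q) F
      & forall e, e \in L -> exists2 F, F \in FF & span x0 c e \in edges F].
  case: L => [|e L] zL sL.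
    by exists set0; split=> [|F|//]; rewrite ?cards0 // inE.
  have [p pQ def_e] := memM _ (sL _ (mem_head _ _)).
  have [g gf pg] := frame_crosses _ (sQ _ pQ).
  have gc := subsetP frame_chords _ gf.
  have [|||F [sF VF LF EF]] := @K4_zigzag T x0 c e L (emb g) uc zL.
  - by apply/allP => f /sL/memM[q _ ->]; apply: pos_lt.
  - by rewrite pos_lt // pos_mono // chord_lt.
  - by rewrite def_e emb_crosses.
  exists [set F]; split; first by rewrite cards1.
    move=> F1 /set1P->.
    have wF : within (frameset :|: Q) F.
      move=> d /EF[ri|->|[f /sL/memM[q qQ ->] ->]]; [by left | right | right].
        by exists g; rewrite // inE gf.
      by exists q; rewrite // inE qQ orbT.
    split=> //; split; last by right.
    apply/andP; split.
      apply/subsetP => v /VF vc; have := next_cycle cc vc.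
      by case/adj_vertices/andP.
    apply/subsetP => d /wF[[i ic ->]|[q qQ ->]]; first exact: rim_edge.
    apply: (subsetP EG).
    have : q \in chords.
      by move: qQ; rewrite inE => /orP[/(subsetP frame_chords)|/chQ].
    by rewrite inE => /and3P[].
  by move=> f fL; exists F; rewrite ?inE ?LF.
have [L1 [L2 [L3 [[z1 z2 z3] defM _ _]]]] := chain_split pM bM.
have [||FF1 [c1 m1 s1]] := single L1 => //; first by move=> e eL; rewrite defM eL.
have [||FF2 [c2 m2 s2]] := single L2 => //; first by move=> e eL; rewrite defM eL orbT.
have [||FF3 [c3 m3 s3]] := single L3 => //; first by move=> e eL; rewrite defM eL !orbT.
exists (FF1 :|: (FF2 :|: FF3)); split.
- apply: leq_trans (leq_card_setU _ _) _; apply: (leq_add c1).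
  by apply: leq_trans (leq_card_setU _ _) _; apply: (leq_add c2).
- by move=> F; rewrite !inE => /or3P[/m1|/m2|/m3].
- move=> p pQ; have : emb p \in M by apply/memM; exists p.
  rewrite defM => /or3P[/s1|/s2|/s3] [F FF eF]; exists F; rewrite // !inE FF ?orbT //.
Qed.

(** Each value of [key] below [N] contributes one chain. The class [l] is recorded because it limits
    the chords that a member can contain. *)
Let class_family (frameset : {set 'I_h * 'I_h}) (key : 'I_h * 'I_h -> nat) N :
  spans_crossings frameset ->
  (forall p q, p \in chords -> q \in chords -> p != q -> key p = key q ->
     lt2 (vals p) (vals q) || lt2 (vals q) (vals p)) ->
  exists FF : {set graph T},
    [/\ #|FF| <= 3 * N,
        forall F, F \in FF -> member G F /\ exists l,
          within (frameset :|: [set p in chords :\: frameset | key p == l]) F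
      & forall p, p \in chords :\: frameset -> key p < N ->
          exists2 F, F \in FF & edge p \in edges F].
Proof.
move=> frameP chain; elim: N => [|N [FF [cFF mFF sFF]]].
  by exists set0; rewrite cards0; split=> // F; rewrite inE.
pose Q := [set p in chords :\: frameset | key p == N].
have [||FF1 [cFF1 mFF1 sFF1]] := @chain_family frameset Q frameP.
- by apply/subsetP => p; rewrite inE => /andP[].
- move=> p q; rewrite [p \in Q]inE [q \in Q]inE !in_setD.
  move=> /andP[/andP[_ pc] /eqP pN] /andP[/andP[_ qc] /eqP qN] npq.
  by apply: chain; rewrite ?pN.
exists (FF :|: FF1); split.
- apply: leq_trans (leq_card_setU _ _) _; rewrite mulnSr.
  exact: leq_add.
- move=> F; rewrite in_setU => /orP[/mFF//|/mFF1[mF wF]].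
  by split=> //; exists N.
- move=> p pc; rewrite ltnS leq_eqVlt => /orP[pN|pN].
    have [|F FF1F eF] := sFF1 p; first by rewrite inE pc.
    by exists F; rewrite // in_setU FF1F orbT.
  have [F FFF eF] := sFF p pc pN.
  by exists F; rewrite // in_setU FFF.
Qed.

(** A chord that crosses nothing in an inclusion-maximal noncrossing set could be added to it. *)
Let maximal_noncrossing :
  exists2 frameset : {set 'I_h * 'I_h},
    spans_crossings frameset & #|frameset| <= h.
Proof.
pose nc (X : {set 'I_h * 'I_h}) := (X \subset chords) &&
  [forall p in X, forall q in X, ~~ crosses (vals p) (vals q)].
have nc0 : nc set0.
  by rewrite /nc sub0set; apply/forall_inP => p; rewrite inE.
have [X /maxsetP[/andP[Xc /forall_inP ncX] maxX] _] := maxset_exists nc0.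
have ncXX p q : p \in X -> q \in X -> ~~ crosses (vals p) (vals q).
  by move=> pX qX; apply: (forall_inP (ncX p pX)).
exists X; last first.
  apply: noncrossing_bound => // p /(subsetP Xc).
  by rewrite inE => /and3P[].
split=> // p; rewrite in_setD => /andP[pX pc].
apply/exists_inP; apply: contraR pX => /exists_inPn ncp.
have ncpp : ~~ crosses (vals p) (vals p) by rewrite /crosses ltnn.
rewrite -(maxX (p |: X)) ?subsetUr ?setU11 //.
apply/andP; split; first by rewrite subUset sub1set pc.
apply/forall_inP => a /setU1P[->|aX]; apply/forall_inP => b /setU1P[->|bX] //.
- exact: ncp.
- by rewrite crossesC; exact: ncp.
- exact: ncXX.
Qed.

Let not_in_class (Q : {set 'I_h * 'I_h}) F q :
  within Q F -> Q \subset chords -> q \in chords -> q \notin Q ->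
  edge q \notin edges F.
Proof.
move=> wF /subsetP Qc qc qQ; apply/negP => /wF[[i ic /rim_chord]|[p pQ]].
  exact.
by move/(edge_inj qc (Qc _ pQ)) => eq_qp; rewrite eq_qp pQ in qQ.
Qed.

(** [A] consists of the edges between cyclically consecutive marked vertices and of a maximal
    noncrossing set, at most [#|W|] of each; [H] consists of the other chords. [FF1] is built from
    the differences and [FF2] from the skew differences. Two distinct chords of [H] differ in one of
    these keys, and a member for the first chord's class under that key omits the second chord. *)
Lemma marked_cycle_families :
  exists (A H : {set {set T}}) (FF1 FF2 : {set graph T}),
    [/\ [/\ A \subset E, H \subset E, E \subset A :|: H & #|A| <= 2 * #|W|],
        #|FF1| <= 3 * #|W| /\ #|FF2| <= 6 * #|W|,
        forall F, F \in FF1 :|: FF2 -> member G F,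
        forall e, e \in H -> exists2 F, F \in FF1 & e \in edges F
      & forall e f, e \in H -> f \in H -> e != f ->
          exists2 F, F \in FF1 :|: FF2 & (e \in edges F) && (f \notin edges F)].
Proof.
rewrite -size_marked.
have [X spX cX] := maximal_noncrossing; have [Xc _] := spX.
pose key1 (p : 'I_h * 'I_h) := p.2 - p.1.
pose key2 (p : 'I_h * 'I_h) := h + p.2 - 2 * p.1.
have [|FF1 [c1 m1 s1]] := @class_family X key1 h spX.
  move=> p q /chord_lt p12 /chord_lt q12; rewrite pair_ord_neq.
  exact: difference_chain.
(* Skew differences of chords lie below [2 * h], because [p.2 < h]. *)
have [|FF2 [c2 m2 s2]] := @class_family X key2 (2 * h) spX.
  move=> p q /chord_lt p12 /chord_lt q12; rewrite pair_ord_neq.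
  by apply: (@skew_difference_chain h); rewrite ltn_ord andbT.
pose nxt (i : 'I_h) := [set nth x0 marked i; nth x0 marked (i.+1 %% h)].
pose A := (E :&: nxt @: [set: 'I_h]) :|: edge @: X.
have ordered u w : u \in marked -> w \in marked ->
    index u marked < index w marked -> [set u; w] \in E ->
    [set u; w] \in A :|: edge @: (chords :\: X).
  move=> um wm ij uwE.
  have [ih jh] : index u marked < h /\ index w marked < h by rewrite !index_mem.
  pose i := Ordinal ih; pose j := Ordinal jh.
  have edge_ij : edge (i, j) = [set u; w].
    by rewrite /edge /span /= !nth_pos // !nth_index.
  rewrite !in_setU in_setI uwE.
  case: (ltnP i.+1 j) => [ij1|ji]; last first.
    apply/orP; left; apply/orP; left; apply/imsetP; exists i; rewrite // /nxt.
    have -> : i.+1 = j by apply/eqP; rewrite eqn_leq ji ij.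
    by rewrite modn_small //= !nth_index.
  case ij0: ((val i == 0) && (val j == h.-1)).
    case/andP: ij0 => /eqP i0 /eqP j0.
    (* The first and the last marked vertex form the pair [nxt j], as [j.+1] wraps around to [0]. *)
    apply/orP; left; apply/orP; left; apply/imsetP; exists j; rewrite // /nxt.
    have -> : j.+1 = h by rewrite [nat_of_ord j]j0 prednK // (leq_trans _ ih).
    by rewrite modnn -i0 /= !nth_index // setUC.
  have ijc : (i, j) \in chords by rewrite inE ij1 ij0 edge_ij.
  case ijX: ((i, j) \in X).
    apply/orP; left; apply/orP; right; apply/imsetP.
    by exists (i, j).
  apply/orP; right; apply/imsetP; exists (i, j) => //.
  by rewrite in_setD ijX ijc.
exists A, (edge @: (chords :\: X)), FF1, FF2; split.
- split.
  + rewrite subUset subsetIl; apply/subsetP => e /imsetP[p /(subsetP Xc)].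
    by rewrite inE => /and3P[_ _ pE] ->.
  + apply/subsetP => e /imsetP[p]; rewrite in_setD inE => /andP[_ /and3P[_ _ pE]] ->.
    exact: pE.
  + apply/subsetP => e Ee.
    have [/eqP/cards2P[u [w [uw def_e]]] _] := graph_edge (subsetP EG _ Ee).
    have in_marked v : v \in e -> v \in marked.
      by move=> ve; have vW := subsetP (EW Ee) v ve; rewrite mem_filter vW Wc.
    have [um wm] : u \in marked /\ w \in marked.
      by split; apply: in_marked; rewrite def_e !inE eqxx ?orbT.
    move: Ee; rewrite def_e; case: (ltngtP (index u marked) (index w marked)).
    * exact: ordered.
    * by rewrite setUC; exact: ordered.
    * by move/index_inj => eq_uw; rewrite eq_uw ?eqxx in uw.
  + rewrite mul2n -addnn; apply: leq_trans (leq_card_setU _ _) _.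
    apply: leq_add; last exact: leq_trans (leq_imset_card _ _) cX.
    apply: leq_trans (subset_leq_card (subsetIr _ _)) _.
    by apply: leq_trans (leq_imset_card _ _) _; rewrite cardsT card_ord.
- by rewrite -[6]/(3 * 2) -mulnA.
- by move=> F; rewrite in_setU => /orP[/m1[]|/m2[]].
- move=> e /imsetP[p pc ->]; apply: s1 => //.
  by rewrite /key1 (leq_ltn_trans (leq_subr _ _)) // ltn_ord.
- move=> e f /imsetP[p pc ->] /imsetP[q qc ->] npq.
  have [pch pX] := setDP pc; have [qch qX] := setDP qc.
  have classP key l F : within (X :|: [set p in chords :\: X | key p == l]) F ->
      edge p \in edges F -> key p != key q -> edge q \notin edges F.
    move=> wF pF npk.
    have sub : X :|: [set p in chords :\: X | key p == l] \subset chords.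
      rewrite subUset Xc; apply/subsetP => r; rewrite inE in_setD.
      by case/andP => /andP[].
    apply: (not_in_class wF sub qch).
    have : p \in X :|: [set p in chords :\: X | key p == l].
      by apply: contraLR pF; exact: (not_in_class wF sub pch).
    rewrite !in_setU (negbTE pX) (negbTE qX) !inE => /andP[_ /eqP <-].
    by rewrite [key q == _]eq_sym (negbTE npk) andbF.
  have p12 := chord_lt pch; have q12 := chord_lt qch.
  case: (eqVneq (key1 p) (key1 q)) => [eq1|ne1].
    have ne2 : key2 p != key2 q.
      apply: contra npq => /eqP eq2; apply/eqP; congr edge.
      apply/eqP; rewrite -pair_eqE.
      by apply: (differences_inj _ _ eq1 eq2); rewrite ltn_ord andbT.
    have [|F F2 pF] := s2 p pc.
      rewrite /key2; have := ltn_ord p.2; move: p12.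
      by move: (nat_of_ord p.1) (nat_of_ord p.2) => a b; clear; lia.
    exists F; rewrite ?in_setU ?F2 ?orbT // pF.
    by have [_ [l wF]] := m2 F F2; exact: classP wF pF ne2.
  have [|F F1 pF] := s1 p pc.
    by rewrite /key1 (leq_ltn_trans (leq_subr _ _)) // ltn_ord.
  exists F; rewrite ?in_setU ?F1 // pF.
  by have [_ [l wF]] := m1 F F1; exact: classP wF pF ne1.
Qed.

End MarkedCycle.

(** * Removing vertex sets *)

Lemma graph_of (T : finType) (V : {set T}) (E : {set {set T}}) :
  (forall e, e \in E -> #|e| = 2 /\ e \subset V) ->
  exists2 F : graph T, vertices F = V & edges F = E.
Proof.
move=> EP; have ax : graph_axiom (V, E).
  by apply/forall_inP => e /EP[-> ->]; rewrite eqxx.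
by exists (Graph ax).
Qed.

Lemma member_trans (T : finType) (G G' F : graph T) :
  subgraph G' G -> member G' F -> member G F.
Proof.
move=> /andP[sV sE] [/andP[sV' sE'] kind]; split=> //.
by rewrite /subgraph (subset_trans sV') ?(subset_trans sE').
Qed.

Lemma single_edge_family (T : finType) (G : graph T) (A : {set {set T}}) :
  A \subset edges G ->
  exists FF : {set graph T},
    [/\ #|FF| <= #|A|, forall F, F \in FF -> member G F
      & forall e, e \in A -> exists2 F, F \in FF & edges F = [set e]].
Proof.
move=> AG; pose f e := insubd G (e, [set e]).
have fE e : e \in A -> vertices (f e) = e /\ edges (f e) = [set e].
  move=> /(subsetP AG)/graph_edge[ce _].
  rewrite /vertices /edges /f insubdK // unfold_in /=.
  by apply/forall_inP => d /set1P ->; rewrite ce eqxx /=.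
exists (f @: A); split.
- exact: leq_imset_card.
- move=> _ /imsetP[e eA ->]; have [vf ef] := fE e eA; split.
    rewrite /subgraph vf ef sub1set (subsetP AG _ eA) andbT.
    by have [] := graph_edge (subsetP AG _ eA).
  by left; exists e.
- by move=> e eA; exists (f e); [exact: imset_f | have [] := fE e eA].
Qed.

(** All edges at [S] lie inside $W = S \cup N(S)$, so the families for a cycle through [W] apply.
    The constants come from [#|W| <= 3 * #|S|]: 6 is 2 times 3, 9 is 3 times 3, and 18 is 6 times
    3. *)
Lemma reduction_step (T : finType) (G : graph T) :
  vertices G != set0 ->
  exists (S W : {set T}) (A H : {set {set T}}) (FF1 FF2 : {set graph T}),
    [/\ [/\ 0 < #|S|, S \subset vertices G, W \subset vertices G
          & #|W| <= 3 * #|S|],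
        [/\ A \subset edges G, H \subset edges G, incident G S \subset A :|: H,
            A :|: H \subset incident G S & forall e, e \in H -> e \subset W],
        [/\ #|A| <= 6 * #|S|, #|FF1| <= 9 * #|S| & #|FF2| <= 18 * #|S|],
        (forall F, F \in FF1 :|: FF2 -> member G F) /\
        forall e, e \in H -> exists2 F, F \in FF1 & e \in edges F
      & forall e f, e \in H -> f \in H -> e != f ->
          exists2 F, F \in FF1 :|: FF2 & (e \in edges F) && (f \notin edges F)].
Proof.
move=> V0; have [S [S0 WV cW]] := rotation_cycle V0.
set W := S :|: nbhd G S in WV cW *.
have S1 : 0 < #|S| by rewrite card_gt0.
have SV : S \subset vertices G by apply: subset_trans WV; exact: subsetUl.
have EG : incident G S \subset edges G.
  by apply/subsetP => e; rewrite inE => /andP[].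
case=> [[c [uc cc szc Wc]]|c1].
  have EW e : e \in incident G S -> e \subset W.
    move=> /incidentP[s [u [sS su ->]]]; apply/subsetP => v.
    rewrite !inE => /orP[]/eqP->; rewrite ?sS //.
    by apply/orP; right; apply/existsP; exists s; rewrite sS.
  have [x0 _] : exists x0, x0 \in S by apply/set0Pn.
  have [A [H [FF1 [FF2 [[AE HE EAH cA] [c1 c2] mFF cov sep]]]]] :=
    marked_cycle_families x0 uc cc szc Wc EG EW.
  exists S, W, A, H, FF1, FF2; split=> //.
  - split=> //; first exact: subset_trans EG.
      exact: subset_trans EG.
    + by rewrite subUset AE HE.
    + by move=> e /(subsetP HE)/EW.
  - split.
    + by apply: leq_trans cA _; rewrite -[6]/(2 * 3) -mulnA leq_mul2l.
    + by apply: leq_trans c1 _; rewrite -[9]/(3 * 3) -mulnA leq_mul2l.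
    + by apply: leq_trans c2 _; rewrite -[18]/(6 * 3) -mulnA leq_mul2l.
(* In the case without a cycle, at most one edge meets [S], and it is taken as a single edge. *)
exists S, W, (incident G S), set0, set0, set0; split=> //.
- by split; rewrite ?setU0 ?sub0set // => e; rewrite inE.
- split; rewrite ?cards0 //; apply: leq_trans c1 _.
  by rewrite muln_gt0.
- by split=> [F|e]; rewrite ?setU0 inE.
- by move=> e f; rewrite inE.
Qed.

Lemma delete_vertices (T : finType) (G : graph T) (S : {set T}) :
  exists2 G' : graph T, vertices G' = vertices G :\: S
    & edges G' = edges G :\: incident G S.
Proof.
apply: graph_of => e; rewrite in_setD inE negb_and negbK => /andP[eS Ge].
have [ce se] := graph_edge Ge; split=> //.
by rewrite subsetD se; move: eS; rewrite Ge.
Qed.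

(** Each deleted vertex costs 6 single edges for [A] and 9 members of [FF1], 15 in total. *)
Lemma covering_family (T : finType) (G : graph T) :
  exists FF : {set graph T},
    [/\ #|FF| <= 15 * #|vertices G|, forall F, F \in FF -> member G F
      & forall e, e \in edges G -> exists2 F, F \in FF & e \in edges F].
Proof.
have [k] := ubnP #|vertices G|; elim: k G => // k IHk G ltk.
have [V0|] := eqVneq (vertices G) set0.
  exists set0; rewrite cards0; split=> // [F|e /graph_edge[ce]]; first by rewrite inE.
  by rewrite V0 subset0 => /eqP e0; rewrite e0 cards0 in ce.
move=> /reduction_step[S [W [A [H [FF1 [FF2 [[S1 SV _ _] [AG HG EAH _ _]
  [cA c1 _] [mFF cov] _]]]]]]].
have [G' VG' EG'] := delete_vertices G S.
have cV : #|vertices G| = #|S| + #|vertices G'|.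
  by rewrite VG' -(cardsID S (vertices G)) (setIidPr SV).
have sG : subgraph G' G by rewrite /subgraph VG' EG' !subsetDl.
have [|FF [cFF mF covF]] := IHk G'; first by move: ltk; rewrite cV; lia.
have [FA [cFA mA covA]] := single_edge_family AG.
exists (FA :|: (FF1 :|: FF)); split.
- apply: leq_trans (leq_card_setU _ _) _.
  apply: leq_trans (leq_add (leqnn _) (leq_card_setU _ _)) _.
  by rewrite cV; clear - cFA cA c1 cFF; lia.
- move=> F; rewrite !in_setU => /or3P[/mA//|F1|/mF]; last exact: member_trans.
  by apply: mFF; rewrite in_setU F1.
- move=> e Ge; case: (boolP (e \in incident G S)) => [/(subsetP EAH)|eS].
    rewrite in_setU => /orP[/covA[F FFA eF]|/cov[F FF1F eF]].
      by exists F; rewrite ?in_setU ?FFA // eF inE.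
    by exists F; rewrite ?in_setU ?FF1F ?orbT.
  have [|F FFF eF] := covF e; first by rewrite EG' in_setD eS.
  by exists F; rewrite ?in_setU ?FFF ?orbT.
Qed.

(** Covering is carried through the induction because it separates remaining edges from deleted
    ones: a member for [G'] is a subgraph of [G'] and thus avoids every edge at [S]. *)
Lemma separating_covering_family (T : finType) (G : graph T) :
  exists FF : {set graph T},
    [/\ #|FF| <= 82 * #|vertices G|, forall F, F \in FF -> member G F,
        forall e, e \in edges G -> exists2 F, F \in FF & e \in edges F
      & forall e f, e \in edges G -> f \in edges G -> e != f ->
          exists2 F, F \in FF & (e \in edges F) && (f \notin edges F)].
Proof.
have [k] := ubnP #|vertices G|; elim: k G => // k IHk G ltk.
have [V0|] := eqVneq (vertices G) set0.
  have E0 e : e \notin edges G.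
    apply/negP => /graph_edge[ce]; rewrite V0 subset0 => /eqP e0.
    by rewrite e0 cards0 in ce.
  exists set0; rewrite cards0; split=> // [F|e|e f]; first by rewrite inE.
    by move=> Ge; case/negP: (E0 e).
  by move=> Ge; case/negP: (E0 e).
move=> /reduction_step[S [W [A [H [FF1 [FF2 [[S1 SV WV cW] [AG HG EAH AHE HW]
  [cA c1 c2] [mFF cov] sep]]]]]]].
have [G' VG' EG'] := delete_vertices G S.
have cV : #|vertices G| = #|S| + #|vertices G'|.
  by rewrite VG' -(cardsID S (vertices G)) (setIidPr SV).
have sG : subgraph G' G by rewrite /subgraph VG' EG' !subsetDl.
have [|FF [cFF mF covF sepF]] := IHk G'; first by move: ltk; rewrite cV; lia.
have [FA [cFA mA covA]] := single_edge_family AG.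
(* Members of [FF1] and [FF2] may use edges of the cycle outside [H]. A subgraph of [K] has edges in
   [H] only, so covering [K] separates [H] from all other edges. *)
have [K VK EK] : exists2 K : graph T, vertices K = W & edges K = H.
  apply: graph_of => e eH; split; last exact: HW.
  by have [] := graph_edge (subsetP HG _ eH).
have sK : subgraph K G by rewrite /subgraph VK EK WV HG.
have [FK [cFK mK covK]] := covering_family K.
pose new := FA :|: (FF1 :|: FF2 :|: FK).
have separate e f : e \in incident G S -> e != f ->
    exists2 F, F \in new & (e \in edges F) && (f \notin edges F).
  move=> /(subsetP EAH); rewrite in_setU => /orP[/covA[F FFA eF] nef|eH nef].
    by exists F; rewrite ?in_setU ?FFA // eF !inE eqxx eq_sym.
  case: (boolP (f \in H)) => [fH|fH].
    have [F FF12 efF] := sep e f eH fH nef.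
    by exists F; rewrite // 2!in_setU FF12 orbT.
  have [|F FFK eF] := covK e; first by rewrite EK.
  exists F; first by rewrite 2!in_setU FFK !orbT.
  rewrite eF; apply: contra fH => fF.
  by have [/andP[_ /subsetP sFK] _] := mK F FFK; rewrite -EK; exact: sFK.
exists (new :|: FF); split.
- apply: leq_trans (leq_card_setU _ _) _.
  apply: leq_trans (leq_add (leq_card_setU _ _) (leqnn _)) _.
  have cU := leq_trans (leq_card_setU (FF1 :|: FF2) FK)
    (leq_add (leq_card_setU FF1 FF2) (leqnn #|FK|)).
  rewrite VK in cFK; rewrite cV.
  (* Per vertex of [S] the cost is at most 6 for [A], 9 and 18 for the two families, and 15 times 3
     for covering [K], which makes 78 and stays below 82. *)
  by clear - cU cFA cA c1 c2 cFF cFK cW; lia.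
- move=> F; rewrite 3!in_setU -!orbA => /or4P[/mA//|h|/mK|/mF];
    [exact: mFF | exact: member_trans | exact: member_trans].
- move=> e Ge; case: (boolP (e \in incident G S)) => [eS|eS].
    case/(subsetP EAH)/setUP: (eS) => [/covA[F FFA eF]|/cov[F FF1F eF]].
      by exists F; rewrite ?in_setU ?FFA // eF inE.
    by exists F; rewrite ?in_setU ?FF1F ?orbT.
  have [|F FFF eF] := covF e; first by rewrite EG' in_setD eS.
  by exists F; rewrite ?in_setU ?FFF ?orbT.
- move=> e f Ge Gf nef; case: (boolP (e \in incident G S)) => [eS|eS].
    have [F nF efF] := separate e f eS nef.
    by exists F; rewrite // in_setU nF.
  have G'e : e \in edges G' by rewrite EG' in_setD eS.
  case: (boolP (f \in incident G S)) => [fS|fS]; last first.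
    have [|F FFF efF] := sepF e f G'e _ nef; first by rewrite EG' in_setD fS.
    by exists F; rewrite // in_setU FFF orbT.
  have [F FFF eF] := covF e G'e; exists F; first by rewrite in_setU FFF orbT.
  rewrite eF; have [/andP[_ /subsetP sF] _] := mF F FFF.
  by apply/negP => /sF; rewrite EG' in_setD fS.
Qed.

Theorem theorem4 (T : finType) (G : graph T) (n : nat)
    (hn : #|vertices G| = n) :
  exists FF : {set graph T},
    separating_system (complete_graph 4) G FF /\ #|FF| <= 82 * n.
Proof.
have [FF [cFF mFF _ sepFF]] := separating_covering_family G.
by exists FF; rewrite -hn.
Qed.
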